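(* Let $\sigma_W>0$. For positive integers $m,n$ let $W\in\mathbb{R}^{m\times n}$ have i.i.d. entries $W_{i,j}\sim\mathcal{N}(0,\sigma_W^2)$, and let $A\in\mathbb{R}^{n\times n}$ and $B\in\mathbb{R}^{m\times m}$ be symmetric positive definite. Fix an entropy coding scheme that encodes the integer matrix $Z$ with expected length $\mathrm{Ent}(Z)+o(mn)$ bits. Let $L^{(A)}=\mathrm{RevCholesky}(A)$ and $L^{(B)}=\mathrm{RevCholesky}(B)$. For $\gamma>0$, run the two-sided GPTQ algorithm (described in the context) on $(W,A,B,\alpha,\beta)$ with scales $$\alpha_j=\sqrt{\gamma}\cdot\frac{|A|^{1/(2n)}}{L^{(A)}_{j,j}}\quad(1\le j\le n),\qquad \beta_i=\sqrt{\gamma}\cdot\frac{|B|^{1/(2m)}}{L^{(B)}_{i,i}}\quad(1\le i\le m),$$ and encode its output $Z$ with the entropy coding scheme. Then the distortion $D_{A,B}$ and the rate $R$ satisfy $$D_{A,B}=\frac{\gamma^2}{12}\,|A|^{1/n}|B|^{1/m}\,(1+o(1)),\qquad R=\tfrac12\log_2(2\pi e\,\sigma_W^2)-\log_2\gamma+o(1)$$ as $\gamma\to0$ and $mn\to\infty$. Consequently the rate-distortion tradeoff $$D_{A,B}=\frac{2\pi e}{12}\,\sigma_W^2\,|A|^{1/n}|B|^{1/m}\,2^{-2R}\,(1+o(1))$$ holds. In the limit, this is within $\tfrac12\log_2(2\pi e/12)\approx0.255$ bits of the limiting rate given by the lower bound $D_{A,B}\ge\sigma_W^2|A|^{1/n}|B|^{1/m}2^{-2R}$,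 that is, $$R-\tfrac12\log_2\!\left(\frac{\sigma_W^2|A|^{1/n}|B|^{1/m}}{D_{A,B}}\right)= \tfrac12\log_2\!\left(\frac{2\pi e}{12}\right)+o(1).$$
   Context: Notation. $|M|$ is the determinant of a square matrix $M$. For a symmetric positive definite $M$, $\mathrm{RevCholesky}(M)$ is the unique lower-triangular $L$ with positive diagonal entries such that $L^TL=M$, and $M^{1/2}$ is any matrix $S$ with $SS^T=M$ (the quantities below do not depend on the choice). $\|\cdot\|_F$ is the Frobenius norm. $\mathrm{Ent}(Z)$ is the Shannon entropy, in bits, of the random integer matrix $Z$. Quantized matrix. Given $Z\in\mathbb{Z}^{m\times n}$ and scales $\alpha\in\mathbb{R}_{>0}^n$, $\beta\in\mathbb{R}_{>0}^m$, the quantized matrix is $V\in\mathbb{R}^{m\times n}$ with $V_{i,j}=\alpha_j\beta_iZ_{i,j}$. Two-sided GPTQ algorithm. Input: $W,A,B,\alpha,\beta$. Let $L^{(A)}=\mathrm{RevCholesky}(A)$, $L^{(B)}=\mathrm{RevCholesky}(B)$, and let $\tilde L^{(A)}$, $\tilde L^{(B)}$ be obtained from $(L^{(A)})^{-1}$, $(L^{(B)})^{-1}$ by dividing each column by its diagonal entry. Maintain a working copy $W'$, initially $W'=W$. For $j=1,\dots,n$ (outer loop) and $i=1,\dots,m$ (inner loop): set $Z_{i,j}=\mathrm{round}(W'_{i,j}/(\alpha_j\beta_i))$ (nearest integer), $V_{i,j}=\alpha_j\beta_iZ_{i,j}$, $\Delta=V_{i,j}-W'_{i,j}$, and update $W'\leftarrow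 W'+\Delta\,\tilde L^{(B)}_{:,i}(\tilde L^{(A)}_{:,j})^T$, where $M_{:,k}$ denotes the $k$-th column of $M$. Output: $Z$ (and hence $V$). Distortion and rate. With $W$ the original matrix, $$D_{A,B}=\frac1{mn}\mathbb{E}_W\big[\|(B^{1/2})^T(V-W)A^{1/2}\|_F^2\big],$$ and $R=\frac1{mn}$ times the expected (over $W$) length of the self-delimiting (prefix-free) binary string encoding $Z$. The matrices $A,B$ are deterministic. The scales $\alpha,\beta$ are not encoded: the decoder is given access to them (equivalently to $A,B$). Meaning of the limit. The joint limit $\gamma\to0$, $mn\to\infty$ is understood in the iterated sense: first $\gamma\to0$ for fixed $m,n,A,B$, then $mn\to\infty$. That is, a quantity $\varepsilon$ depending on $(m,n,A,B,\gamma)$ is $o(1)$ if for every sequence $(m_k,n_k,A_k,B_k)$ of such data with $m_kn_k\to\infty$ one has $\lim_{k\to\infty}\limsup_{\gamma\to0}|\varepsilon(m_k,n_k,A_k,B_k,\gamma)|=0$; and a quantity is $o(mn)$ if it equals $mn\cdot o(1)$ in this sense. $\sigma_W$ is fixed. *)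

(* Defs.v *)
From HB Require Import structures.
From mathcomp Require Import all_boot all_order all_algebra.
From mathcomp Require Import all_classical all_reals all_analysis.

Set Implicit Arguments.
Unset Strict Implicit.
Unset Printing Implicit Defensive.

Import Order.TTheory GRing.Theory Num.Theory.
Import numFieldNormedType.Exports.

Local Open Scope classical_set_scope.
Local Open Scope ring_scope.

Definition log2 (R : realType) (x : R) : R := ln x / ln 2.

Section matrices.
Context {R : realType}.

Definition spdmx n (M : 'M[R]_n) : Prop :=
  M^T = M /\ forall u : 'cV[R]_n, u != 0 -> 0 < (u^T *m M *m u) 0 0.

Definition is_rev_cholesky n (M L : 'M[R]_n) : Prop :=
  [/\ forall i j : 'I_n, (i < j)%N -> L i j = 0,
      forall i : 'I_n, 0 < L i i
    & L^T *m L = M].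

(* The default value 0 is only reached when [M] is not positive definite. *)
Definition rev_cholesky n (M : 'M[R]_n) : 'M[R]_n :=
  xget 0 [set L | is_rev_cholesky M L].

Definition frobenius_norm m n (M : 'M[R]_(m, n)) : R :=
  Num.sqrt (\sum_i \sum_j M i j ^+ 2).

End matrices.

Section gptq.
Context {R : realType}.
Variables (m n : nat).
Implicit Types (alpha : 'I_n -> R) (beta : 'I_m -> R).

Definition quantized alpha beta (Z : 'M[int]_(m, n)) : 'M[R]_(m, n) :=
  \matrix_(i, j) (alpha j * beta i * (Z i j)%:~R).

(* No convention is fixed for the rounding of half-integers. *)
Definition is_nearest_int (round : R -> int) : Prop :=
  forall x, `|x - (round x)%:~R| <= 2^-1.

Definition normalized_inverse p (L : 'M[R]_p) : 'M[R]_p :=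
  \matrix_(i, j) (invmx L i j / invmx L j j).

(* The state is the pair of the working copy W' and of the integer matrix Z,
   of which only the entries visited so far are meaningful. *)
Definition gptq_step (round : R -> int) (tLA : 'M[R]_n) (tLB : 'M[R]_m)
    alpha beta (i : 'I_m) (j : 'I_n) (st : 'M[R]_(m, n) * 'M[int]_(m, n)) :
    'M[R]_(m, n) * 'M[int]_(m, n) :=
  let: (W', Z) := st in
  let z := round (W' i j / (alpha j * beta i)) in
  let delta := alpha j * beta i * z%:~R - W' i j in
  (W' + delta *: (col i tLB *m (col j tLA)^T),
   \matrix_(k, l) if (k == i) && (l == j) then z else Z k l).

Definition gptq (round : R -> int) (W : 'M[R]_(m, n)) (A : 'M[R]_n)
    (B : 'M[R]_m) alpha beta : 'M[int]_(m, n) :=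
  let tLA := normalized_inverse (rev_cholesky A) in
  let tLB := normalized_inverse (rev_cholesky B) in
  (foldl (fun st j =>
     foldl (fun st' i => gptq_step round tLA tLB alpha beta i j st')
       st (enum 'I_m))
     (W, 0) (enum 'I_n)).2.

End gptq.

(* The geometric-mean scales sqrt g * |M|^(1/(2p)) / L_(k,k), used with M = A
   for alpha and with M = B for beta. *)
Definition gptq_scale (R : realType) p (M : 'M[R]_p) (g : R) (k : 'I_p) : R :=
  Num.sqrt g * \det M `^ (2 * p)%:R^-1 / rev_cholesky M k k.

Section information.
Context {d} {T : measurableType d} {R : realType} (P : probability T R).

Definition mutually_independent (I : finType) (X : I -> {RV P >-> R}) : Prop :=
  forall (J : {set I}) (E : I -> set R), (forall i, measurable (E i)) ->
    P (\bigcap_(i in [set` J]) X i @^-1` E i) =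
    (\prod_(i in J) P (X i @^-1` E i))%E.

Definition iid_normal (I : finType) (sigma : R) (X : I -> {RV P >-> R}) :=
  (forall i (E : set R), measurable E ->
     distribution P (X i) E = normal_prob 0 sigma E) /\
  mutually_independent X.

(* Shannon entropy in bits; [log2 0 = 0] in the terms of probability zero. *)
Definition entropy (S : choiceType) (Z : T -> S) : \bar R :=
  \esum_(z in [set: S])
    (let p := fine (P (Z @^-1` [set z])) in (- (p * log2 p))%:E).

End information.

Definition prefix_free (S : eqType) (c : S -> seq bool) : Prop :=
  forall x y, prefix (c x) (c y) -> x = y.

Record instance (R : realType) := Instance {
  nrow : nat;
  ncol : nat;
  matA : 'M[R]_ncol;
  matB : 'M[R]_nrow;
  nrow_gt0 : (0 < nrow)%N;
  ncol_gt0 : (0 < ncol)%N;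
  matA_spd : spdmx matA;
  matB_spd : spdmx matB }.

Arguments nrow {R} _.
Arguments ncol {R} _.
Arguments matA {R} _.
Arguments matB {R} _.

(* Iterated limit: g -> 0 with the instance fixed, then m n -> oo. *)
Definition is_o1 (R : realType) (eps : instance R -> R -> R) : Prop :=
  forall s : nat -> instance R,
    (fun k => (nrow (s k) * ncol (s k))%N) @ \oo --> \oo ->
    (fun k => limf_esup (fun g : R => `|eps (s k) g|%:E) 0^'+) @ \oo --> 0%E.

Section two_sided_gptq.
Context {R : realType}.
Variables (round : R -> int) (x : instance R) (g : R).

Definition scaleA : 'I_(ncol x) -> R := gptq_scale (matA x) g.
Definition scaleB : 'I_(nrow x) -> R := gptq_scale (matB x) g.

Definition Zout (W : 'M[R]_(nrow x, ncol x)) : 'M[int]_(nrow x, ncol x) :=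
  gptq round W (matA x) (matB x) scaleA scaleB.

Definition Vout (W : 'M[R]_(nrow x, ncol x)) : 'M[R]_(nrow x, ncol x) :=
  quantized scaleA scaleB (Zout W).

Context {d} {T : measurableType d} (P : probability T R).
Variable W : 'I_(nrow x) * 'I_(ncol x) -> {RV P >-> R}.

Definition random_matrix (w : T) : 'M[R]_(nrow x, ncol x) :=
  \matrix_(i, j) W (i, j) w.

Definition entropyZ : \bar R := entropy P (Zout \o random_matrix).

Definition expected_length (c : 'M[int]_(nrow x, ncol x) -> seq bool) : \bar R :=
  'E_P[fun w => (size (c (Zout (random_matrix w))))%:R].

Definition rate (c : 'M[int]_(nrow x, ncol x) -> seq bool) : \bar R :=
  (((nrow x * ncol x)%:R^-1)%:E * expected_length c)%E.

(* [SA] and [SB] stand for A^(1/2) and B^(1/2). *)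
Definition distortion (SA : 'M[R]_(ncol x)) (SB : 'M[R]_(nrow x)) : \bar R :=
  (((nrow x * ncol x)%:R^-1)%:E *
   'E_P[fun w => (frobenius_norm
     (SB^T *m (Vout (random_matrix w) - random_matrix w) *m SA) ^+ 2)%R])%E.

End two_sided_gptq.

(* |A|^(1/n) |B|^(1/m) *)
Definition geodet (R : realType) (x : instance R) : R :=
  \det (matA x) `^ (ncol x)%:R^-1 * \det (matB x) `^ (nrow x)%:R^-1.

(* Main.v *)
Require Import Defs.
From HB Require Import structures.
From mathcomp Require Import all_boot all_order all_algebra.
From mathcomp Require Import all_classical all_reals all_analysis.
From mathcomp Require Import measurable_realfun.
From mathcomp Require Import ring lra zify.

Import Order.TTheory GRing.Theory Num.Theory.
Import numFieldNormedType.Exports.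

Local Open Scope classical_set_scope.
Local Open Scope ring_scope.

(* Both updates of GPTQ are unitriangular once the inverse Cholesky factors are
   normalized, so V - W = M_B E (M_A)^T, where M_A, M_B are the normalized
   inverses and E_(i,j) is the rounding error committed when (i, j) is visited.
   Multiplying by the Cholesky factors diagonalizes both sides:
   D = 1/(mn) sum_(i,j) (L^A_(j,j) L^B_(i,i))^2 E[E_(i,j)^2].
   With the scales of the theorem the step at (i, j) is
   s_(i,j) = g |A|^(1/2n) |B|^(1/2m) / (L^A_(j,j) L^B_(i,i)), so every summand is
   g^2 |A|^(1/n) |B|^(1/m) / 12 + O(g^3) as soon as E[E_(i,j)^2] is
   s_(i,j)^2 / 12 + O(s_(i,j)^3). This holds because the working copy at (i, j)
   is W_(i,j) plus a drift that depends on the entries visited before only: by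
   independence the drift may be frozen, and rounding a shifted Gaussian with a
   small step has mean squared error s^2/12 + O(s^3), uniformly in the shift.

   For the entropy, the event Z = z has Lebesgue volume prod s_(i,j) = g^(mn)
   (the map from W to the working copy is a triangular shear) and sits within
   O(g) of one point, so that on it
   - ln P(Z = z) = - mn ln g - sum_(i,j) ln phi(W_(i,j)) + O(g sum (1 + W^2));
   integrating gives mn times the differential entropy of N(0, sigma^2) minus
   mn ln g, up to O(g). The errors in D and Ent(Z) are thus O(g) for a fixed
   instance, and the remaining claims are algebra on these two expansions. *)

(** * Reverse Cholesky factors and weighted Frobenius norms *)

Section rev_cholesky_theory.
Context {R : realType}.

Lemma det_is_rev_cholesky n (M L : 'M[R]_n) :
  is_rev_cholesky M L -> \det L = \prod_i L i i.
Proof. by move=> [Ltri _ _]; apply: det_trig; apply/is_trig_mxP. Qed.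

Lemma is_rev_cholesky_unit n (M L : 'M[R]_n) :
  is_rev_cholesky M L -> L \in unitmx.
Proof.
move=> ML; rewrite unitmxE unitfE (det_is_rev_cholesky _ _ _ ML).
by apply/prodf_neq0 => i _; case: ML => _ /(_ i)/lt0r_neq0.
Qed.

Lemma spdmx_drsubmx n (M : 'M[R]_(1 + n)) : spdmx M -> spdmx (drsubmx M).
Proof.
move=> [Msym Mpos]; split=> [|u u0]; first by rewrite trmx_drsub Msym.
have cu0 : col_mx (0 : 'M[R]_1) u != 0.
  by apply: contra u0 => /eqP; rewrite -col_mx0 => /eq_col_mx[_ ->].
have := Mpos _ cu0.
rewrite -{1}[M]submxK tr_col_mx mul_row_block mul_row_col.
by rewrite trmx0 !mul0mx mulmx0 !add0r.
Qed.

(* The Schur complement of the lower right block [C] of [M] is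
   [a - v^T *m v] with [L'^T *m v] the lower left block and [L'^T *m L' = C]. *)
Lemma rev_cholesky_exists n (M : 'M[R]_n) :
  spdmx M -> exists L, is_rev_cholesky M L.
Proof.
elim: n M => [|n IHn] M Mspd.
  by exists M; split; [case|case|rewrite [LHS]flatmx0 [RHS]flatmx0].
move: M Mspd; rewrite -[n.+1]/(1 + n)%N => M Mspd.
have [L' CL'] := IHn _ (spdmx_drsubmx _ _ Mspd).
have L'unit := is_rev_cholesky_unit _ _ _ CL'.
case: CL' => L'tri L'diag L'C; case: Mspd => Msym Mpos.
pose b := ursubmx M; have bT : dlsubmx M = b^T by rewrite /b trmx_ursub Msym.
pose v := invmx L'^T *m b^T.
have L'v : L'^T *m v = b^T by rewrite /v mulKVmx// unitmx_tr.
have vL' : v^T *m L' = b by apply: trmx_inj; rewrite trmx_mul trmxK.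
pose w := invmx L' *m v.
have L'w : L' *m w = v by rewrite /w mulKVmx.
have wL' : w^T *m L'^T = v^T by rewrite -trmx_mul L'w.
(* Since [w] solves the linear system of the lower right block with right-hand side [b^T], the
   quadratic form at (1, -w) is the Schur complement, whose positivity allows the square root
   below. *)
have u0 : col_mx (1%:M : 'M[R]_1) (- w) != 0.
  apply/eqP; rewrite -col_mx0 => /eq_col_mx[/matrixP/(_ 0 0)].
  by rewrite !mxE => /eqP; rewrite oner_eq0.
have := Mpos _ u0.
rewrite -{1}[M]submxK tr_col_mx mul_row_block mul_row_col bT -/b -L'C -L'v -vL'.
rewrite trmx1 !mul1mx mulmx1 linearN /= !mulNmx !mulmxN mulmxDl !mulNmx.
rewrite !mulmxA wL' -!mulmxA L'w subrr subr0.
set d := (X in 0 < X) => d_gt0.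
have dE : ulsubmx M = d%:M + v^T *m v.
  rewrite [LHS]mx11_scalar [v^T *m v]mx11_scalar -raddfD /=; congr _%:M.
  rewrite /d; set X := v^T *m v; rewrite !mxE; ring.
exists (block_mx (Num.sqrt d)%:M 0 v L'); split=> [i j|i|].
- rewrite -(splitK i) -(splitK j); case: (fintype.split i) => i'; case: (fintype.split j) => j' /=.
  + by rewrite !ord1.
  + by rewrite block_mxEur mxE.
  + by rewrite ord1.
  + by rewrite block_mxEdr ltn_add2l; exact: L'tri.
- rewrite -(splitK i); case: (fintype.split i) => i' /=.
  + by rewrite block_mxEul ord1 mxE eqxx mulr1n sqrtr_gt0.
  + by rewrite block_mxEdr.
- rewrite tr_block_mx mulmx_block trmx0 !mul0mx !mulmx0 !add0r tr_scalar_mx.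
  rewrite -scalar_mxM -expr2 sqr_sqrtr ?ltW// -dE L'v vL' L'C -bT.
  exact: submxK.
Qed.

Lemma rev_choleskyP n (M : 'M[R]_n) :
  spdmx M -> is_rev_cholesky M (rev_cholesky M).
Proof. by move=> /rev_cholesky_exists ML; exact: (xgetPex 0 ML). Qed.

Lemma det_rev_cholesky n (M : 'M[R]_n) : spdmx M ->
  \det M = (\prod_i rev_cholesky M i i) ^+ 2.
Proof.
move=> /rev_choleskyP ML; rewrite -(det_is_rev_cholesky _ _ _ ML).
by case: ML => _ _ {1}<-; rewrite det_mulmx det_tr expr2.
Qed.

Lemma frobenius_normE m n (M : 'M[R]_(m, n)) :
  frobenius_norm M ^+ 2 = \tr (M^T *m M).
Proof.
rewrite /frobenius_norm sqr_sqrtr; last first.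
  by apply: sumr_ge0 => i _; apply: sumr_ge0 => j _; exact: sqr_ge0.
rewrite exchange_big; apply: eq_bigr => j _; rewrite mxE.
by apply: eq_bigr => i _; rewrite mxE expr2.
Qed.

(** By cyclicity of the trace both sides are tr(A X^T B X). Any square roots may thus be traded for
    the transposed Cholesky factors. *)
Lemma frobenius_norm_sqrt m n (A SA LA : 'M[R]_n) (B SB LB : 'M[R]_m)
    (X : 'M[R]_(m, n)) :
  SA *m SA^T = A -> SB *m SB^T = B -> LA^T *m LA = A -> LB^T *m LB = B ->
  frobenius_norm (SB^T *m X *m SA) ^+ 2 = frobenius_norm (LB *m X *m LA^T) ^+ 2.
Proof.
move=> SAA SBB LAA LBB; rewrite !frobenius_normE !trmx_mul !trmxK.
rewrite !mulmxA mxtrace_mulC [RHS]mxtrace_mulC !mulmxA SAA LAA -!mulmxA.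
by rewrite (mulmxA SB) SBB (mulmxA LB^T) LBB.
Qed.

End rev_cholesky_theory.

(** * Rounding with error feedback *)

Section sequential_rounding.
Context {R : realType} {I : eqType}.
Variables (round : R -> int) (s : I -> R) (U : I -> I -> R).
Hypothesis round_nearest : is_nearest_int round.
Hypothesis s_gt0 : forall k, 0 < s k.
Implicit Types (ks : seq I) (w : I -> R).

Definition quant_err k x : R := s k * (round (x / s k))%:~R - x.

(* [ks] lists the visited indices, the most recent one first; the working copy
   is [w + drift ks w]. *)
Fixpoint drift ks w l : R :=
  if ks is k :: ks' then
    drift ks' w l + quant_err k (w k + drift ks' w k) * U k l
  else 0.

(** Unvisited indices get the code 0, as in the zero matrix from which [gptq] starts. *)
Fixpoint quant_code ks w l : int :=
  if ks is k :: ks' then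
    if l == k then round ((w k + drift ks' w k) / s k) else quant_code ks' w l
  else 0.

Fixpoint err ks w l : R :=
  if ks is k :: ks' then
    if l == k then quant_err k (w k + drift ks' w k) else err ks' w l
  else 0.

Lemma quant_err_le k x : `|quant_err k x| <= s k / 2.
Proof.
have -> : quant_err k x = - (s k * (x / s k - (round (x / s k))%:~R)).
  by rewrite /quant_err; field; rewrite gt_eqF.
rewrite normrN normrM gtr0_norm// ler_pM2l//; exact: round_nearest.
Qed.

Lemma err_le ks w l : `|err ks w l| <= s l / 2.
Proof.
elim: ks => [|k ks IH] /=; first by rewrite normr0 divr_ge0// ltW.
by case: eqP => // ->; exact: quant_err_le.
Qed.

(** The bound does not depend on [w]: this is what confines each code cell to a bounded region. *)
Lemma drift_le ks w l :
  `|drift ks w l| <= \sum_(k <- ks) s k / 2 * `|U k l|.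
Proof.
elim: ks => [|k ks IH] /=; first by rewrite big_nil normr0.
rewrite big_cons addrC (le_trans (ler_normD _ _))// lerD//.
by rewrite normrM ler_wpM2r// quant_err_le.
Qed.

(** [err] keeps only the most recent visit of an index, so the recursion unfolds into this sum when
    no index is visited twice. *)
Lemma driftE ks w l : uniq ks ->
  drift ks w l = \sum_(k <- ks) err ks w k * U k l.
Proof.
elim: ks => [|k ks IH] /=; first by rewrite big_nil.
case/andP=> kks uks; rewrite big_cons eqxx addrC IH//; congr (_ + _).
by apply: eq_big_seq => k' k'ks; case: eqP k'ks kks => // -> ->.
Qed.

(** The visit of [k] adds its own error with coefficient 1, which moves the working copy exactly
    onto the grid. The pairwise condition says that later visits, which stand earlier in the list,
    leave that entry alone. *)
Lemma drift_code ks w k : (forall k, U k k = 1) -> uniq ks ->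
  pairwise (fun k l => U k l == 0) ks -> k \in ks ->
  w k + drift ks w k = s k * (quant_code ks w k)%:~R.
Proof.
move=> U1; elim: ks => [//|k' ks IH] /= /andP[k'ks uks] /andP[/allP Uk' pks].
rewrite inE; case: eqP => [-> _|_ /= kks].
  by rewrite U1 mulr1 /quant_err; ring.
by rewrite (eqP (Uk' _ kks)) mulr0 addr0 IH.
Qed.

End sequential_rounding.

(** * Inverses of triangular factors, and GPTQ as sequential rounding *)

Section lower_triangular.
Context {R : realType}.

(** Strong induction on the row: in entry (i, j) of L L^-1 = 1 the terms k > i vanish by
    triangularity and the terms k < i by induction, leaving only L i i times the wanted entry. *)
Lemma invmx_lower n (L : 'M[R]_n) :
  (forall i j : 'I_n, (i < j)%N -> L i j = 0) -> (forall i, L i i != 0) ->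
  L \in unitmx -> forall i j : 'I_n, (i <= j)%N ->
  invmx L i j = (i == j)%:R / L i i.
Proof.
move=> Ltri Ld Lu i; have [N] := ubnP i; elim: N i => // N IH i iN j ij.
have := mulmxV Lu => /matrixP/(_ i j); rewrite !mxE (bigD1 i)//= big1 ?addr0.
  by move=> <-; rewrite mulrC mulKf.
move=> k ki; have [ik|ki'] := ltnP i k; first by rewrite Ltri// mul0r.
have {ki' ki}ki : (k < i)%N.
  by rewrite ltn_neqAle ki' andbT; apply: contra ki => /eqP/val_inj ->.
rewrite IH ?(leq_trans ki)// ?(ltnW (leq_trans ki _))//.
by rewrite -val_eqE/= ltn_eqF ?mul0r ?mulr0// (leq_trans ki).
Qed.

Lemma rev_cholesky_lower_inv n (M : 'M[R]_n) : spdmx M ->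
  let L := rev_cholesky M in
  forall i j : 'I_n, (i <= j)%N -> invmx L i j = (i == j)%:R / L i i.
Proof.
move=> /rev_choleskyP ML; apply: invmx_lower.
- by case: ML.
- by case: ML => _ Ld _ i; rewrite gt_eqF.
- exact: is_rev_cholesky_unit ML.
Qed.

Lemma normalized_inverse_lower n (M : 'M[R]_n) (i j : 'I_n) : spdmx M ->
  (i < j)%N -> normalized_inverse (rev_cholesky M) i j = 0.
Proof.
move=> spdM ij; rewrite mxE (rev_cholesky_lower_inv _ _ spdM _ _ (ltnW ij)).
by rewrite -val_eqE/= ltn_eqF// !mul0r.
Qed.

Lemma normalized_inverse_diag n (M : 'M[R]_n) (i : 'I_n) : spdmx M ->
  normalized_inverse (rev_cholesky M) i i = 1.
Proof.
move=> spdM; rewrite mxE divff// (rev_cholesky_lower_inv _ _ spdM _ _ (leqnn _)).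
rewrite eqxx mul1r invr_eq0.
by have [_ Ld _] := rev_choleskyP _ _ spdM; rewrite gt_eqF.
Qed.

(** The j-th diagonal entry of L^-1 is 1 / L j j, so normalizing the columns of L^-1 is right
    multiplication by the diagonal of L. *)
Lemma mul_normalized_inverse n (M : 'M[R]_n) : spdmx M ->
  rev_cholesky M *m normalized_inverse (rev_cholesky M) =
  diag_mx (\row_i rev_cholesky M i i).
Proof.
move=> spdM; set L := rev_cholesky M; have ML := rev_choleskyP _ _ spdM.
have -> : normalized_inverse L = invmx L *m diag_mx (\row_i L i i).
  apply/matrixP => i j; rewrite mul_mx_diag !mxE.
  rewrite (rev_cholesky_lower_inv _ _ spdM _ _ (leqnn j)).
  by rewrite eqxx mul1r invrK.
by rewrite mulKVmx// (is_rev_cholesky_unit _ _ _ ML).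
Qed.

End lower_triangular.

Section gptq_sequential.
Context {R : realType} {m n : nat}.

(* Visiting order of GPTQ, columns in the outer loop, last entry first. *)
Definition visits : seq ('I_m * 'I_n) :=
  rev [seq (i, j) | j <- enum 'I_n, i <- enum 'I_m].

Lemma visits_uniq : uniq visits.
Proof.
by rewrite rev_uniq allpairs_uniq ?enum_uniq// => -[i j] [k l] _ _ [-> ->].
Qed.

Lemma mem_visits p : p \in visits.
Proof.
case: p => i j; rewrite mem_rev.
by apply/allpairsP; exists (j, i); rewrite !mem_enum.
Qed.

Let earlier : rel ('I_m * 'I_n) :=
  fun p q => (p.2 < q.2)%N || (p.2 == q.2) && (p.1 < q.1)%N.

Let earlier_trans : transitive earlier.
Proof.
move=> [i2 j2] [i1 j1] [i3 j3]; rewrite /earlier /= -!val_eqE /=; lia.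
Qed.

Let visits_pairwise : pairwise (fun q p => earlier p q) visits.
Proof.
have tr : transitive (fun q p => earlier p q).
  by move=> a b c ba cb; apply: earlier_trans cb ba.
rewrite -sorted_pairwise// /visits rev_sorted sorted_pairwise//.
have ltn_enum k : pairwise (fun i j : 'I_k => (i < j)%N) (enum 'I_k).
  have := pairwise_map val ltn (enum 'I_k); rewrite val_enum_ord => <-.
  by rewrite -sorted_pairwise ?iota_ltn_sorted//; exact: ltn_trans.
elim: (enum 'I_n) (ltn_enum n) => //= j js IH /andP[/allP jjs pjs].
rewrite pairwise_cat IH// andbT pairwise_map; apply/andP; split.
  apply/allrelP => _ _ /mapP[i _ ->] /allpairsP[[j' i'] /= [j'js _ ->]].
  by rewrite /earlier /= jjs.
by apply: sub_pairwise (ltn_enum m) => i i' /= ii'; rewrite /earlier/= eqxx ii' orbT.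
Qed.

Variables (round : R -> int) (A : 'M[R]_n) (B : 'M[R]_m).
Variables (alpha : 'I_n -> R) (beta : 'I_m -> R).
Hypotheses (spdA : spdmx A) (spdB : spdmx B).

Definition step_size (p : 'I_m * 'I_n) : R := alpha p.2 * beta p.1.

(** The rank-one update read entrywise: the coefficient with which the error committed at [k] is
    added to entry [l]. *)
Definition feedback (k l : 'I_m * 'I_n) : R :=
  normalized_inverse (rev_cholesky B) l.1 k.1 *
  normalized_inverse (rev_cholesky A) l.2 k.2.

Lemma feedback_diag k : feedback k k = 1.
Proof. by rewrite /feedback !normalized_inverse_diag// mulr1. Qed.

(** An entry visited before [q] has a smaller column, or the same column and a smaller row; the
    matching factor is then strictly above the diagonal. *)
Lemma feedback_visits : pairwise (fun k l => feedback k l == 0) visits.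
Proof.
apply: sub_pairwise visits_pairwise => q p; rewrite /feedback.
case/orP => [pq|/andP[_ pq]]; first by rewrite (normalized_inverse_lower _ A) ?mulr0.
by rewrite (normalized_inverse_lower _ B) ?mul0r.
Qed.

Lemma gptqE (W : 'M[R]_(m, n)) (i : 'I_m) (j : 'I_n) :
  gptq round W A B alpha beta i j =
  quant_code round step_size feedback visits (fun p => W p.1 p.2) (i, j).
Proof.
rewrite /gptq; set tLA := normalized_inverse _; set tLB := normalized_inverse _.
pose stp st (p : 'I_m * 'I_n) := gptq_step round tLA tLB alpha beta p.1 p.2 st.
rewrite -[foldl _ _ _]/(foldl (fun st j => foldl (fun st' i => stp st' (i, j)) st
  (enum 'I_m)) (W, 0) (enum 'I_n)).
have -> st js : foldl (fun st j => foldl (fun st' i => stp st' (i, j)) st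
    (enum 'I_m)) st js = foldl stp st [seq (i, j) | j <- js, i <- enum 'I_m].
  elim: js st => //= j' js IH st; rewrite IH foldl_cat; congr foldl.
  by elim: (enum 'I_m) st => //=.
rewrite -[X in foldl _ _ X]revK -/visits.
set w := fun p => _.
(* The invariant describes the whole state: the codes alone would not determine the next
   rounding. *)
suff -> ks : foldl stp (W, 0) (rev ks) =
    (\matrix_(k, l) (W k l + drift round step_size feedback ks w (k, l)),
     \matrix_(k, l) quant_code round step_size feedback ks w (k, l)).
  by rewrite mxE.
elim: ks => [|[k l] ks IH] /=.
  by congr pair; apply/matrixP => ? ?; rewrite !mxE ?addr0.
rewrite rev_cons foldl_rcons {}IH /stp /gptq_step /= !mxE.
congr pair; apply/matrixP => k' l'; rewrite !mxE.
  rewrite big_ord1 !mxE /quant_err /feedback /step_size /= -addrA; congr (_ + _).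
  by rewrite [normalized_inverse _ k' _]mxE [normalized_inverse _ l' _]mxE.
by rewrite xpair_eqE.
Qed.

Lemma frobenius_gptq (W : 'M[R]_(m, n)) :
  frobenius_norm (rev_cholesky B *m
    (quantized alpha beta (gptq round W A B alpha beta) - W) *m
    (rev_cholesky A)^T) ^+ 2 =
  \sum_p (rev_cholesky A p.2 p.2 * rev_cholesky B p.1 p.1 *
    err round step_size feedback visits (fun p => W p.1 p.2) p) ^+ 2.
Proof.
pose w (p : 'I_m * 'I_n) := W p.1 p.2.
set e := err round step_size feedback visits w.
set LA := rev_cholesky A; set LB := rev_cholesky B.
have -> : quantized alpha beta (gptq round W A B alpha beta) - W =
    normalized_inverse LB *m (\matrix_(i, j) e (i, j)) *m
    (normalized_inverse LA)^T.
  apply/matrixP => i j; rewrite mxE [quantized _ _ _ _ _]mxE gptqE.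
  (* Once every entry has been visited the working copy equals V, so V - W is the final drift. *)
  have := drift_code round step_size feedback visits w (i, j) feedback_diag
    visits_uniq feedback_visits (mem_visits _).
  rewrite -/w {1}/step_size /= => <-; rewrite !mxE {1}/w /= addrAC subrr add0r.
  rewrite driftE ?visits_uniq// -/e.
  rewrite (eq_bigr (fun l => \sum_k (normalized_inverse LB i k * e (k, l)
      * normalized_inverse LA j l))); last first.
    move=> l _; rewrite !mxE big_distrl /=.
    by apply: eq_bigr => k _; rewrite mxE.
  rewrite exchange_big pair_big /= [RHS](perm_big visits) /=; last first.
    apply: uniq_perm; rewrite ?index_enum_uniq ?visits_uniq// => p.
    by rewrite mem_visits mem_index_enum.
  by apply: eq_bigr => -[k l] _; rewrite /feedback /=; ring.
rewrite -mulmxA -!mulmxA -trmx_mul mul_normalized_inverse// !mulmxA.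
rewrite mul_normalized_inverse// tr_diag_mx.
rewrite /frobenius_norm sqr_sqrtr; last first.
  by apply: sumr_ge0 => i _; apply: sumr_ge0 => j _; exact: sqr_ge0.
rewrite pair_big /=; apply: eq_bigr => -[i j] _ /=; congr (_ ^+ 2).
by rewrite mul_mx_diag mul_diag_mx !mxE mulrAC [X in X * _]mulrC.
Qed.

End gptq_sequential.

(** * Gaussian integrals and rounding cells *)

Section normal_integrals.
Context {R : realType}.
Notation mu := (@lebesgue_measure R).

(** The density agrees almost everywhere with the Radon-Nikodym derivative, since both have the same
    integral over every measurable set. *)
Lemma ge0_integral_normal_prob (m s : R) (f : _ -> \bar R) :
  measurable_fun [set: R] f -> (forall x, (0 <= f x)%E) ->
  (\int[normal_prob m s]_x f x = \int[mu]_x (f x * (normal_pdf m s x)%:E))%E.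
Proof.
move=> mf f0; have dom := @normal_prob_dominates R m s.
rewrite -(Radon_Nikodym_SigmaFinite.change_of_variables dom)//.
have RNint := Radon_Nikodym_SigmaFinite.f_integrable dom.
apply: ae_eq_integral => //.
- by apply: emeasurable_funM => //; exact: (measurable_int mu).
- apply: emeasurable_funM => //; apply/measurable_EFinP.
  exact: measurable_normal_pdf.
- apply: ae_eqe_mul2l; apply: integral_ae_eq => //.
  + by apply/measurable_EFinP; exact: measurable_normal_pdf.
  + by move=> E _ mE; rewrite -Radon_Nikodym_SigmaFinite.f_integral.
Qed.

Variable s : R.
Hypothesis s_gt0 : 0 < s.
Notation phi := (normal_pdf 0 s).

Let phiE x : phi x = normal_peak s * expR (- (x ^+ 2) / (s ^+ 2 *+ 2)).
Proof. by rewrite normal_pdfE ?gt_eqF// /normal_fun subr0. Qed.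

Let continuous_phi : continuous phi.
Proof. by apply: continuous_normal_pdf; rewrite gt_eqF. Qed.

(** The integration by parts behind the second moment: this primitive vanishes at 0 and at infinity,
    so x^2 / s^2 and 1 have the same integral against the density. *)
Lemma is_derive_normal_moment1 (x : R) :
  is_derive x 1 (fun y => y * phi y) ((1 - x ^+ 2 / s ^+ 2) * phi x).
Proof.
have -> : (fun y => y * phi y) =
    (fun y => y * (normal_peak s * expR (y ^+ 2 * - (s ^+ 2 *+ 2)^-1))).
  by apply/funext => y; rewrite phiE mulNr mulrN.
apply: is_derive_eq.
rewrite phiE mulrN mulNr /GRing.scale /=; set E := expR _.
by field; rewrite gt_eqF.
Qed.

Lemma cvg_normal_moment1 : y * phi y @[y --> +oo] --> (0 : R).
Proof.
have s2 : 0 < s ^+ 2 by rewrite exprn_gt0.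
have ps : 0 < normal_peak s by rewrite normal_peak_gt0 ?gt_eqF.
(* The upper bound comes from t < exp t at t = y^2 / (2 s^2). *)
apply: (@squeeze_cvgr _ _ _ _ (cst 0)
  (fun y : R => 2 * s ^+ 2 * normal_peak s * y^-1)).
- near=> y; have y0 : 0 < y by near: y; exact: nbhs_pinfty_gt.
  apply/andP; split; first by rewrite mulr_ge0 ?normal_pdf_ge0// ltW.
  rewrite phiE mulNr expRN; set t := y ^+ 2 / _.
  have tE : t * (2 * s ^+ 2) = y ^+ 2 by rewrite /t; field; rewrite gt_eqF.
  have t0 : 0 < t by rewrite divr_gt0 ?exprn_gt0// mulrn_wgt0.
  have et : t < expR t by rewrite (lt_le_trans _ (expR_ge1Dx _))// ltrDr.
  rewrite mulrA ler_pdivrMr ?expR_gt0// mulrAC ler_pdivlMr//.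
  rewrite (_ : y * normal_peak s * y = normal_peak s * y ^+ 2); last by ring.
  rewrite -tE (_ : 2 * s ^+ 2 * normal_peak s * expR t =
    normal_peak s * (expR t * (2 * s ^+ 2))); last by ring.
  by rewrite ler_pM2l// ler_pM2r ?mulr_gt0// ltW.
- exact: cvg_cst.
- rewrite -[0 in X in _ --> X](mulr0 (2 * s ^+ 2 * normal_peak s)).
  apply: cvgM; first exact: cvg_cst.
  by apply/gtr0_cvgV0; [exact: nbhs_pinfty_gt|exact: cvg_id].
Unshelve. all: by end_near. Qed.

Let F (y : R) : R := y * phi y.
Let f (y : R) : R := (1 - y ^+ 2 / s ^+ 2) * phi y.

Let derivable_F x : derivable F x 1.
Proof. exact: (@ex_derive _ _ _ _ _ _ _ (is_derive_normal_moment1 x)). Qed.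

Let F'E : (F^`())%classic = f.
Proof.
by apply/funext => x; rewrite derive1E; apply: derive_val; exact: is_derive_normal_moment1.
Qed.

Let continuous_F : continuous F.
Proof.
by move=> x; apply: differentiable_continuous; apply/derivable1_diffP.
Qed.

Let continuous_q : continuous (fun y : R => y ^+ 2 / s ^+ 2 * phi y).
Proof.
move=> x; apply: cvgM; last exact: continuous_phi.
by apply: cvgM; [exact: exprn_continuous|exact: cvg_cst].
Qed.

Let continuous_f : continuous f.
Proof.
move=> x; apply: cvgM; last exact: continuous_phi.
apply: cvgB; first exact: cvg_cst.
by apply: cvgM; [exact: exprn_continuous|exact: cvg_cst].
Qed.

Let q_ge0 (y : R) : 0 <= y ^+ 2 / s ^+ 2 * phi y.
Proof. by rewrite mulr_ge0 ?normal_pdf_ge0// divr_ge0// sqr_ge0. Qed.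

Let measurable_q D : measurable_fun D (fun y : R => y ^+ 2 / s ^+ 2 * phi y).
Proof. by apply: measurable_funTS; exact: continuous_measurable_fun. Qed.

Let measurable_f D : measurable_fun D f.
Proof. by apply: measurable_funTS; exact: continuous_measurable_fun. Qed.

Let measurable_phi D : measurable_fun D phi.
Proof. by apply: measurable_funTS; exact: continuous_measurable_fun. Qed.

(** The derivative [f] changes sign at [s]. Cutting the half-line there keeps every integrand
    nonnegative; the boundary term [F s] enters the total of [phi] on the left piece and the total
    of the second moment on the right piece, so the totals agree. *)
Let integral_phi_itv0s : (\int[mu]_(y in `[0%R, s]) (phi y)%:E =
  (F s)%:E + \int[mu]_(y in `[0%R, s]) (y ^+ 2 / s ^+ 2 * phi y)%:E)%E.
Proof.
have <- : (\int[mu]_(y in `[0%R, s]) (f y)%:E = (F s)%:E)%E.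
  rewrite (@continuous_FTC2 _ f F) ?F'E//.
  - by rewrite /F mul0r sube0.
  - exact: continuous_subspaceT.
  - split; first by move=> x _; exact: derivable_F.
    + exact/cvg_at_right_filter/continuous_F.
    + exact/cvg_at_left_filter/continuous_F.
rewrite -ge0_integralD//=.
- by apply: eq_integral => y _; rewrite -EFinD /f mulrBl mul1r subrK.
- move=> y; rewrite in_itv/= => /andP[y0 ys]; rewrite lee_fin /f.
  rewrite mulr_ge0 ?normal_pdf_ge0// subr_ge0 ler_pdivrMr ?exprn_gt0// mul1r.
  by rewrite ler_pXn2r// nnegrE// ltW.
- by apply/measurable_EFinP; exact: measurable_f.
- by move=> y _; rewrite lee_fin.
- by apply/measurable_EFinP; exact: measurable_q.
Qed.

Let integral_q_itvsy :
  (\int[mu]_(y in `[s, +oo[) (y ^+ 2 / s ^+ 2 * phi y)%:E =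
   (F s)%:E + \int[mu]_(y in `[s, +oo[) (phi y)%:E)%E.
Proof.
have f_le0 x : s <= x -> 0 <= - f x.
  move=> sx; rewrite -mulNr mulr_ge0 ?normal_pdf_ge0// opprB subr_ge0.
  rewrite ler_pdivlMr ?exprn_gt0// mul1r ler_pXn2r// nnegrE ltW//.
  exact: lt_le_trans sx.
have <- : (\int[mu]_(y in `[s, +oo[) (- f y)%:E = (F s)%:E)%E.
  rewrite (@ge0_continuous_FTC2y _ (- f) (- F) s 0)//.
  - by rewrite sub0e EFinN oppeK.
  - by apply: continuous_subspaceT => x; apply: cvgN; exact: continuous_f.
  - by rewrite -oppr0; apply: cvgN; exact: cvg_normal_moment1.
  - by move=> x _; apply: derivableN; exact: derivable_F.
  - by apply: cvgN; exact/cvg_at_right_filter/continuous_F.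
  - by move=> x _; rewrite derive1E deriveN// -derive1E F'E.
rewrite -ge0_integralD//=.
- by apply: eq_integral => y _; rewrite -EFinD /f; congr _%:E; ring.
- by move=> y; rewrite in_itv/= andbT => sy; rewrite lee_fin f_le0.
- by apply/measurable_EFinP/measurableT_comp => //; exact: measurable_f.
- by move=> y _; rewrite lee_fin normal_pdf_ge0.
- by apply/measurable_EFinP; exact: measurable_phi.
Qed.

Let ge0_integral_split (g : R -> R) : (forall y, 0 <= g y) ->
  measurable_fun setT g ->
  (\int[mu]_(y in [set y | (0 <= y)%R]) (g y)%:E =
   \int[mu]_(y in `[0%R, s]) (g y)%:E + \int[mu]_(y in `[s, +oo[) (g y)%:E)%E.
Proof.
move=> g0 mg.
have -> : [set y : R | 0 <= y] = `[0, s] `|` `]s, +oo[.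
  rewrite -set_itvcy; apply/seteqP; split => y /=; rewrite !in_itv/= !andbT.
    by move=> y0; have [ys|ys] := leP y s; [left; rewrite y0|right].
  by move=> [/andP[]//|sy]; exact: le_trans (ltW s_gt0) (ltW sy).
rewrite ge0_integral_setU//=.
- congr (_ + _)%E; rewrite -integral_itv_obnd_cbnd//.
  exact/measurable_EFinP/measurable_funTS.
- exact/measurable_EFinP/measurable_funTS.
- by move=> y _; rewrite lee_fin.
- apply/disj_setPS => y /=; rewrite !in_itv/= andbT => -[/andP[_ ys] sy].
  by move: (le_lt_trans ys sy); rewrite ltxx.
Qed.

Let integral_q : (\int[mu]_y (y ^+ 2 / s ^+ 2 * phi y)%:E = 1)%E.
Proof.
have phiN y : phi y = phi (- y) by rewrite !phiE sqrrN.
rewrite ge0_symfun_integralT//; last first.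
  by move=> y /=; rewrite sqrrN phiN.
rewrite -(integral_normal_pdf 0 s) ge0_symfun_integralT//; last first.
  by move=> y; exact: normal_pdf_ge0.
congr (_ * _)%E; rewrite !ge0_integral_split//; last first.
  by move=> y; exact: normal_pdf_ge0.
rewrite integral_phi_itv0s integral_q_itvsy addeA; congr (_ + _)%E.
exact: addeC.
Qed.

Lemma integral_sqr_normal_prob :
  (\int[normal_prob 0 s]_y (y ^+ 2)%:E = (s ^+ 2)%:E)%E.
Proof.
rewrite ge0_integral_normal_prob//; last 2 first.
- by apply/measurable_EFinP; exact: measurable_funX.
- by move=> y; rewrite lee_fin sqr_ge0.
rewrite -[RHS]mule1 -integral_q -ge0_integralZl_EFin//.
- apply: eq_integral => y _; rewrite -!EFinM mulrA; congr (_ * _)%:E.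
  by rewrite mulrCA divff ?mulr1// gt_eqF// exprn_gt0.
- by move=> y _; rewrite lee_fin.
- by apply/measurable_EFinP; exact: measurable_q.
- exact: sqr_ge0.
Qed.

End normal_integrals.

(** * Integration along the fibers of a map with countable range, and rounding cells *)

Section countable_fibers.
Context {d} {T : measurableType d} {S : countType} (Z : T -> S).
Hypothesis mZ : forall z, measurable (Z @^-1` [set z]).

Let fiber n := if @pickle_inv S n is Some z then Z @^-1` [set z] else set0.

Let mfiber n : measurable (fiber n).
Proof. by rewrite /fiber; case: pickle_inv => [z|]. Qed.

Lemma measurable_fibers (E : set S) : measurable (Z @^-1` E).
Proof.
have -> : Z @^-1` E = \bigcup_n (if n \in (pickle @` E) then fiber n else set0).
  apply/seteqP; split => [x ZxE|x [n _]].
    exists (pickle (Z x)) => //; rewrite ifT /fiber ?pickleK_inv//.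
    by apply/mem_set; exists (Z x).
  case: ifP => // /set_mem[z Ez <-]; rewrite /fiber pickleK_inv.
  by move=> /= ->.
by apply: bigcupT_measurable => n; case: ifP.
Qed.

(** Countable additivity along the enumeration of [S]; indices that encode no element have an empty
    fiber. It serves to sum over rounding cells and to read the entropy as an integral. *)
Lemma ge0_integral_fibers {R : realType} (nu : {measure set T -> \bar R})
    (f : T -> \bar R) :
  measurable_fun [set: T] f -> (forall x, (0 <= f x)%E) ->
  (\int[nu]_x f x = \esum_(z in [set: S]) \int[nu]_(x in Z @^-1` [set z]) f x)%E.
Proof.
move=> mf f0; have TE : [set: T] = \bigcup_n fiber n.
  apply/seteqP; split => // x _; exists (pickle (Z x)) => //.
  by rewrite /fiber pickleK_inv.
rewrite {1}TE ge0_integral_bigcup//; last 2 first.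
- exact: measurable_funTS.
- apply/trivIsetP => i j _ _ ij; apply/seteqP; split => // x [].
  rewrite /fiber; case ei: (pickle_inv i) => [z|//].
  case ej: (pickle_inv j) => [z'|//] /= -> zz'.
  have := @pickle_invK S i; have := @pickle_invK S j; rewrite ei ej /= zz'.
  by move=> zj zi; move: ij; rewrite -zi -zj eqxx.
rewrite nneseries_esumT => [|n]; last exact: integral_ge0.
rewrite [RHS](eq_esum (b := fun z => \int[nu]_(x in fiber (pickle z)) f x)%E); last first.
  by move=> z _; rewrite /fiber pickleK_inv.
rewrite -(esum_image setT (@pickle S) (fun n => \int[nu]_(x in fiber n) f x)%E).
  rewrite [RHS]esum_mkcond; apply: eq_esum => n _.
  case: ifPn => // /negP nP; rewrite /fiber; case en: (pickle_inv n) => [z|].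
    exfalso; apply: nP; apply/mem_set; exists z => //.
    by have := @pickle_invK S n; rewrite en.
  by rewrite integral_set0.
by move=> x y _ _; exact: (pcan_inj pickleK_inv).
Qed.

End countable_fibers.

Section interval_up_to_endpoints.
Context {R : realType}.
Notation mu := (@lebesgue_measure R).
Variables (a b : R) (C : set R).
Hypotheses (abC : `]a, b[ `<=` C) (Cab : C `<=` `[a, b]).

(** The rounding of half-integers is unspecified, so a cell is known only up to its endpoints; each
    endpoint contributes a singleton or nothing. *)
Lemma measurable_between_itv : measurable C.
Proof.
have mpt (c : R) : measurable (C `&` [set c]).
  have [Cc|nCc] := pselect (C c).
    by rewrite setIidr// => _ ->.
  rewrite (_ : _ `&` _ = set0)//.
  by apply/seteqP; split => // _ [/[swap] ->].
have -> : C = `]a, b[ `|` ((C `&` [set a]) `|` (C `&` [set b])).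
  apply/seteqP; split => [y Cy|y [/abC//|[[]|[]]//]].
  have := Cab _ Cy; rewrite /= in_itv/= => /andP[]; rewrite !le_eqVlt.
  move=> /orP[/eqP ay|ay] /orP[/eqP yb|yb].
  - by right; left; split.
  - by right; left; split.
  - by right; right; split.
  - by left; rewrite in_itv/= ay yb.
by apply: measurableU => //; exact: measurableU.
Qed.

Lemma ge0_integral_between_itv (f : R -> \bar R) :
  measurable_fun [set: measurableTypeR R] f -> (forall y, (0 <= f y)%E) ->
  (\int[mu]_(y in C) f y = \int[mu]_(y in `[a, b]) f y)%E.
Proof.
move=> mf f0; have mC := measurable_between_itv.
apply/eqP; rewrite eq_le; apply/andP; split.
  by apply: ge0_subset_integral => //; exact: measurable_funTS.
rewrite integral_itv_bndoo; last exact: measurable_funTS.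
by apply: ge0_subset_integral => //; exact: measurable_funTS.
Qed.

End interval_up_to_endpoints.

Section rounding_cells.
Context {R : realType}.
Notation mu := (@lebesgue_measure R).
Variables (round : R -> int).
Hypothesis round_nearest : is_nearest_int round.

Lemma round_uniq (x : R) (z : int) : `|x - z%:~R| < 2^-1 -> round x = z.
Proof.
move=> xz; have := round_nearest x; set r := round x => xr.
have : `|r%:~R - z%:~R : R| < 1.
  have := ler_distD x r%:~R z%:~R; rewrite (distrC r%:~R x) => rz.
  apply: le_lt_trans rz _; lra.
rewrite -rmorphB -intr_norm -[1]/(1%:~R) ltr_int => rz.
apply/eqP; rewrite -subr_eq0 -normr_eq0; lia.
Qed.

Lemma cell_sup (h a : R) (z : int) : 0 < h ->
  (fun y => round ((y + a) / h)) @^-1` [set z] `<=`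
  `[h * z%:~R - a - h / 2, h * z%:~R - a + h / 2].
Proof.
move=> h0 y /= <-; have := round_nearest ((y + a) / h).
set r : R := (round _)%:~R; rewrite ler_distl => /andP[H1 H2].
move: H1 H2; rewrite ler_pdivlMr// ler_pdivrMr// in_itv/= => H1 H2.
by apply/andP; split; lra.
Qed.

Lemma cell_sub (h a : R) (z : int) : 0 < h ->
  `]h * z%:~R - a - h / 2, h * z%:~R - a + h / 2[ `<=`
  (fun y => round ((y + a) / h)) @^-1` [set z].
Proof.
move=> h0 y /=; rewrite in_itv/= => /andP[H1 H2]; apply: round_uniq.
rewrite ltr_distl ltr_pdivlMr// ltr_pdivrMr//.
by apply/andP; split; lra.
Qed.

Lemma measurable_round_fiber (z : int) : measurable (round @^-1` [set z] : set R).
Proof.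
have H01 : (0 < 1 :> R) by [].
have E : (fun y : R => round ((y + 0) / 1)) = round.
  by apply/funext => y; rewrite addr0 divr1.
have := cell_sup 1 0 z H01; have := cell_sub 1 0 z H01; rewrite E.
exact: measurable_between_itv.
Qed.

Lemma measurable_round_comp d (T : measurableType d) (f : T -> R) (E : set int) :
  measurable_fun setT f -> measurable ((round \o f) @^-1` E).
Proof.
move=> mf; apply: measurable_fibers => z.
by rewrite comp_preimage -[X in measurable X]setTI; apply: mf => //; exact: measurable_round_fiber.
Qed.

Lemma measurable_fun_round d (T : measurableType d) (f : T -> R) :
  measurable_fun setT f -> measurable_fun setT (fun x => (round (f x))%:~R : R).
Proof.
move=> mf _ E mE; rewrite setTI.
exact: (measurable_round_comp _ _ f ((fun z => z%:~R : R) @^-1` E)).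
Qed.

Section one_cell.
Variables (h a : R) (z : int).
Hypothesis h0 : 0 < h.
Let cell := (fun y => round ((y + a) / h)) @^-1` [set z].

Lemma ge0_integral_cell (f : R -> \bar R) :
  measurable_fun [set: measurableTypeR R] f -> (forall y, (0 <= f y)%E) ->
  (\int[mu]_(y in cell) f y =
   \int[mu]_(y in `[(h * z%:~R - a - h / 2)%R, (h * z%:~R - a + h / 2)%R]) f y)%E.
Proof.
by apply: ge0_integral_between_itv; [exact: cell_sub|exact: cell_sup].
Qed.

Lemma measurable_cell : measurable cell.
Proof. by apply: measurable_between_itv; [exact: cell_sub|exact: cell_sup]. Qed.

Lemma lebesgue_measure_cell : mu cell = h%:E.
Proof.
rewrite -[LHS]mul1e -integral_cst; last exact: measurable_cell.
rewrite ge0_integral_cell// integral_cst//= mul1e lebesgue_measure_itv/= lte_fin.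
rewrite ltrD2l ifT; first by rewrite -EFinD; congr _%:E; field.
by rewrite gtrN// divr_gt0.
Qed.

(** On a cell the error is the signed distance to the centre [c]; the primitive (y - c)^3 / 3
    between the ends c - h/2 and c + h/2 gives a value free of the shift and of the code. *)
Lemma integral_cell_sqr :
  (\int[mu]_(y in cell) ((quant_err round (fun=> h) tt (y + a)) ^+ 2)%:E =
   (h ^+ 3 / 12)%:E)%E.
Proof.
pose c := h * z%:~R - a; pose F (y : R) : R := (y - c) ^+ 3 / 3.
transitivity (\int[mu]_(y in cell) ((y - c) ^+ 2)%:E)%E.
  apply: eq_integral => y /set_mem yz; congr _%:E.
  have {}yz : round ((y + a : R) / h) = z by [].
  rewrite /quant_err /= yz /c; ring.
rewrite ge0_integral_cell.
- have dF (x : R) : is_derive x (1 : R) F ((x - c) ^+ 2).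
    by apply: is_derive_eq; rewrite /GRing.scale /=; field.
  rewrite (@continuous_FTC2 _ (fun y => (y - c) ^+ 2) F).
  + by rewrite -EFinD /F /c; congr _%:E; field.
  + by rewrite ltrD2l gtrN// divr_gt0.
  + apply: continuous_subspaceT => x.
    apply: (cvg_comp (fun y => y - c) (fun y => y ^+ 2)); last exact: exprn_continuous.
    by apply: cvgB; [exact: cvg_id|exact: cvg_cst].
  + have cF : continuous F.
      by move=> x; apply: differentiable_continuous; apply/derivable1_diffP; case: (dF x).
    split; first by move=> x _; case: (dF x).
    * exact/cvg_at_right_filter/cF.
    * exact/cvg_at_left_filter/cF.
  + by move=> x _; rewrite derive1E; case: (dF x).
- by apply/measurable_EFinP/measurable_funX/measurable_funB.
- by move=> y; rewrite lee_fin sqr_ge0.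
Qed.

End one_cell.
End rounding_cells.

(** * Regularity of the normal density and high-resolution quantization *)

Section normal_pdf_regularity.
Context {R : realType}.

(** For a <= b the difference is exp(-a) (1 - exp(-(b - a))), and 1 - exp(-u) <= u. *)
Lemma expRN_lipschitz (a b m : R) : m <= a -> m <= b ->
  `|expR (- a) - expR (- b)| <= `|a - b| * expR (- m).
Proof.
wlog ab : a b / a <= b => [H|] ma mb.
  have [ab|/ltW ba] := leP a b; first exact: H.
  by rewrite distrC (distrC a); exact: H.
have eab : expR (- b) <= expR (- a) by rewrite ler_expR lerN2.
rewrite ger0_norm ?subr_ge0// distrC ger0_norm ?subr_ge0//.
have -> : expR (- b) = expR (- a) * expR (- (b - a)).
  by rewrite -expRD; congr expR; ring.
have e1 := expR_ge1Dx (- (b - a)).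
have ema : expR (- a) <= expR (- m) by rewrite ler_expR lerN2.
have ba : 0 <= b - a by rewrite subr_ge0.
apply: (@le_trans _ _ (expR (- a) * (b - a))).
  by rewrite -{1}[expR (- a)]mulr1 -mulrBr ler_wpM2l ?expR_ge0//; lra.
by rewrite mulrC ler_wpM2l.
Qed.

Variable s : R.
Hypothesis s_gt0 : 0 < s.

Let pdfE (t y : R) : 0 < t ->
  normal_pdf 0 t y = normal_peak t * expR (- (y ^+ 2 / (2 * t ^+ 2))).
Proof.
move=> t0; rewrite normal_pdfE ?gt_eqF// /normal_fun subr0 mulNr.
by rewrite -mulr_natl.
Qed.

(* The factor 2 s leaves room for the linear growth of the log-density. *)
Lemma normal_pdf_lipschitz : exists2 K : R, 0 <= K & forall y y' : R,
  `|y - y'| <= 1 ->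
  `|normal_pdf 0 s y - normal_pdf 0 s y'| <=
    K * `|y - y'| * normal_pdf 0 (2 * s) y.
Proof.
have s2 : 0 < s ^+ 2 by rewrite exprn_gt0.
have s20 : 0 < 2 * s by rewrite mulr_gt0.
have p2 : 0 < normal_peak (2 * s) by rewrite normal_peak_gt0 ?gt_eqF.
have p1 : 0 < normal_peak s by rewrite normal_peak_gt0 ?gt_eqF.
pose E := expR ((2 * s ^+ 2)^-1).
exists (normal_peak s / normal_peak (2 * s) * E * (2 + 8 * s ^+ 2) / (2 * s ^+ 2)).
  by rewrite ltW// !(divr_gt0, mulr_gt0, addr_gt0, expR_gt0).
move=> y y' yy'; rewrite !pdfE// -mulrBr normrM gtr0_norm//.
set a := y ^+ 2 / _; set b := y' ^+ 2 / _; set q := y ^+ 2 / (2 * (2 * s) ^+ 2).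
(* [m] lies below both exponents because y'^2 >= y^2 / 2 - 1 when y and y' are within 1. Of the
   factor exp(-2q) in exp(-m), one exp(-q) absorbs the growth of |y + y'| and the other is the
   Gaussian of deviation 2s. *)
pose m := 2 * q - (2 * s ^+ 2)^-1.
have aE : a = 4 * q by rewrite /a /q; field; rewrite gt_eqF.
have q0 : 0 <= q by rewrite divr_ge0 ?sqr_ge0// mulr_ge0 ?sqr_ge0.
have ma : m <= a.
  have : 0 <= (2 * s ^+ 2)^-1 by rewrite invr_ge0 mulr_ge0// ltW.
  rewrite /m aE; lra.
have mb : m <= b.
  have -> : m = (y ^+ 2 / 2 - 1) / (2 * s ^+ 2).
    by rewrite /m /q; field; rewrite gt_eqF.
  rewrite ler_pM2r ?invr_gt0 ?mulr_gt0//.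
  have : (y - y') ^+ 2 <= 1 by rewrite -(real_normK (num_real _)) expr_le1.
  have := sqr_ge0 (y - 2 * y'); nra.
have ab : `|a - b| <= `|y - y'| * ((2 + 8 * s ^+ 2) * expR q / (2 * s ^+ 2)).
  have -> : a - b = (y - y') * ((y + y') / (2 * s ^+ 2)).
    by rewrite /a /b; field; rewrite gt_eqF.
  rewrite normrM ler_wpM2l// normrM [X in _ * X]gtr0_norm ?invr_gt0 ?mulr_gt0//.
  rewrite ler_pM2r ?invr_gt0 ?mulr_gt0//.
  have y1 : `|y + y'| <= 2 * `|y| + 1.
    have := ler_normD y y'; have := ler_normD (y' - y) y.
    by rewrite subrK (distrC y'); move: yy'; lra.
  apply: le_trans y1 _.
  have y2 : 2 * `|y| + 1 <= 2 + y ^+ 2.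
    by rewrite -(real_normK (num_real _)); have := sqr_ge0 (`|y| - 1); nra.
  apply: le_trans y2 _.
  have -> : y ^+ 2 = 8 * s ^+ 2 * q by rewrite /q; field; rewrite gt_eqF.
  have := expR_ge1Dx q; move: q0 s2; nra.
apply: le_trans (_ : normal_peak s * (`|y - y'| *
   ((2 + 8 * s ^+ 2) * expR q / (2 * s ^+ 2)) * expR (- m)) <= _).
  rewrite ler_pM2l//; apply: le_trans (expRN_lipschitz _ _ _ ma mb) _.
  by rewrite ler_wpM2r ?expR_ge0.
have -> : expR (- m) = E * expR (- q) * expR (- q).
  by rewrite /E -!expRD; congr expR; rewrite /m; ring.
rewrite [expR q](_ : _ = (expR (- q))^-1); last by rewrite expRN invrK.
rewrite le_eqVlt; apply/orP; left; apply/eqP; field.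
by rewrite !gt_eqF ?expR_gt0.
Qed.

Lemma normal_prob_le (A : set (measurableTypeR R)) (M v : R) : measurable A ->
  lebesgue_measure A = v%:E -> (forall y, A y -> normal_pdf 0 s y <= M) ->
  (normal_prob 0 s A <= (M * v)%:E)%E.
Proof.
move=> mA Av AM; rewrite EFinM -Av -integral_cst//.
have mpdf : measurable_fun A (EFin \o normal_pdf 0 s).
  by apply/measurable_EFinP/measurable_funTS; exact: measurable_normal_pdf.
apply: ge0_le_integral => //= y Ay; rewrite ?lee_fin ?normal_pdf_ge0//.
Qed.

Lemma normal_prob_ge (A : set (measurableTypeR R)) (M v : R) : measurable A ->
  lebesgue_measure A = v%:E -> 0 <= M -> (forall y, A y -> M <= normal_pdf 0 s y) ->
  ((M * v)%:E <= normal_prob 0 s A)%E.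
Proof.
move=> mA Av M0 AM; rewrite EFinM -Av -integral_cst//.
have mpdf : measurable_fun A (EFin \o normal_pdf 0 s).
  by apply/measurable_EFinP/measurable_funTS; exact: measurable_normal_pdf.
apply: ge0_le_integral => //= y Ay; rewrite ?lee_fin ?normal_pdf_ge0//.
Qed.

End normal_pdf_regularity.

Section uniform_quantization_error.
Context {R : realType}.
Notation mu := (@lebesgue_measure R).
Variables (round : R -> int) (s : R).
Hypothesis round_nearest : is_nearest_int round.
Hypothesis s_gt0 : 0 < s.

(* High-resolution quantization: replacing the density by its value at the
   centre of the current cell costs [O(h)] in [L^1], and then every cell
   contributes [h ^+ 2 / 12] times its mass. *)
Lemma normal_quant_err_sqr : exists2 K : R, 0 <= K & forall h a : R,
  0 < h <= 1 ->
  ((h ^+ 2 / 12 - K * h ^+ 3)%:E <=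
   \int[normal_prob 0 s]_y ((quant_err round (fun=> h) tt (y + a)) ^+ 2)%:E <=
   (h ^+ 2 / 12 + K * h ^+ 3)%:E)%E.
Proof.
have [K K0 lipK] := normal_pdf_lipschitz s s_gt0.
exists K => // h a /andP[h0 h1].
pose Z (y : R) := round ((y + a) / h); pose c (y : R) : R := h * (Z y)%:~R - a.
pose H (y : R) : R := (quant_err round (fun=> h) tt (y + a)) ^+ 2.
have mZ : measurable_fun setT (fun y : R => (Z y)%:~R : R).
  apply: (measurable_fun_round round round_nearest _ _ (fun y : R => (y + a) / h)).
  by apply: measurable_funM => //; exact: measurable_funD.
have mc : measurable_fun setT c.
  by apply: measurable_funB => //; exact: measurable_funM.
have HE y : H y = (c y - y) ^+ 2 by rewrite /H /quant_err /c /Z; ring.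
have mH : measurable_fun setT H.
  by rewrite (funext HE); apply: measurable_funX; exact: measurable_funB.
have cy y : `|c y - y| <= h / 2.
  have := quant_err_le round (fun=> h) round_nearest (fun=> h0) tt (y + a).
  by congr (`| _ | <= _); rewrite /quant_err /c /Z; ring.
have H0 y : 0 <= H y by exact: sqr_ge0.
have Hle y : H y <= h ^+ 2 / 4.
  rewrite HE -(real_normK (num_real _)); have := cy y; have := normr_ge0 (c y - y).
  by move: h0; nra.
pose phi := normal_pdf 0 s; pose phi2 := normal_pdf 0 (2 * s).
have phi0 y : 0 <= phi y by exact: normal_pdf_ge0.
have phi20 y : 0 <= phi2 y by exact: normal_pdf_ge0.
have mphi : measurable_fun setT phi by exact: measurable_normal_pdf.
have mphi2 : measurable_fun setT phi2 by exact: measurable_normal_pdf.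
have mphic : measurable_fun setT (phi \o c) by exact: measurableT_comp.
have lip y : `|phi y - phi (c y)| <= K * h / 2 * phi2 y.
  apply: le_trans (lipK y (c y) _) _.
    by rewrite distrC (le_trans (cy y))//; move: h1; lra.
  rewrite ler_wpM2r ?phi20// -mulrA ler_wpM2l// distrC; exact: cy.
have Hphic : (\int[mu]_y (H y * phi (c y))%:E =
    (h ^+ 2 / 12)%:E * \int[mu]_y (phi (c y))%:E)%E.
  have mZf (z : int) : measurable (Z @^-1` [set z]) by exact: measurable_cell.
  have fib := @ge0_integral_fibers _ (measurableTypeR R) int Z mZf R mu.
  rewrite fib//; last 2 first.
  - by apply/measurable_EFinP; exact: measurable_funM.
  - by move=> y; rewrite lee_fin mulr_ge0.
  rewrite -ge0_integralZl_EFin//; last 3 first.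
  - by move=> y _; rewrite lee_fin.
  - exact/measurable_EFinP.
  - by rewrite divr_ge0// sqr_ge0.
  rewrite [RHS]fib//; last 2 first.
  - by apply: emeasurable_funM => //; exact/measurable_EFinP.
  - by move=> y; rewrite mule_ge0// lee_fin// divr_ge0// sqr_ge0.
  apply: eq_esum => z _; pose p : R := phi (h * z%:~R - a).
  transitivity (\int[mu]_(y in Z @^-1` [set z]) (p%:E * (H y)%:E))%E.
    apply: eq_integral => y /set_mem yz; rewrite -EFinM mulrC; congr (_ * _)%:E.
    by rewrite /p /c (_ : Z y = z).
  rewrite [LHS]ge0_integralZl_EFin//; last 4 first.
  - exact: mZf.
  - by move=> y _; rewrite lee_fin.
  - by apply/measurable_EFinP; exact: measurable_funTS.
  - exact: phi0.
  rewrite [X in (_ * X)%E](integral_cell_sqr round round_nearest h a z h0).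
  transitivity (\int[mu]_(y in Z @^-1` [set z]) (h ^+ 2 / 12 * p)%:E)%E; last first.
    apply: eq_integral => y /set_mem yz; rewrite -EFinM; congr (_ * _)%:E.
    by rewrite /p /c (_ : Z y = z).
  rewrite [RHS]integral_cst; last exact: mZf.
  rewrite [X in _ = (_ * X)%E](lebesgue_measure_cell round round_nearest h a z h0).
  by rewrite -!EFinM; congr _%:E; field.
have intK : (\int[mu]_y (K * h / 2 * phi2 y)%:E = (K * h / 2)%:E)%E.
  under eq_integral do rewrite EFinM.
  rewrite ge0_integralZl_EFin//; last 3 first.
  - by move=> y _; rewrite lee_fin.
  - exact/measurable_EFinP.
  - by rewrite !mulr_ge0// ltW.
  by rewrite integral_normal_pdf mule1.
have intK4 : (\int[mu]_y (h ^+ 2 / 4 * (K * h / 2 * phi2 y))%:E = (K * h ^+ 3 / 8)%:E)%E.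
  under eq_integral do rewrite EFinM.
  rewrite ge0_integralZl_EFin//; last 3 first.
  - by move=> y _; rewrite lee_fin !mulr_ge0// ltW.
  - by apply/measurable_EFinP; exact: measurable_funM.
  - by rewrite divr_ge0// sqr_ge0.
  by rewrite intK -EFinM; congr _%:E; field.
(* Stated with sums instead of differences, so that nonnegative integrals can be compared before
   they are known to be finite. *)
have intle (f g k : R -> R) : (forall y, 0 <= f y) -> (forall y, 0 <= g y) ->
    (forall y, 0 <= k y) -> measurable_fun setT f -> measurable_fun setT g ->
    measurable_fun setT k -> (forall y, f y <= g y + k y) ->
    (\int[mu]_y (f y)%:E <= \int[mu]_y (g y)%:E + \int[mu]_y (k y)%:E)%E.
  move=> f0 g0 k0 mf mg mk fgk; rewrite -ge0_integralD//.
  - apply: ge0_le_integral => //.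
    + by move=> y _; rewrite lee_fin.
    + exact/measurable_EFinP.
    + by apply: emeasurable_funD; exact/measurable_EFinP.
    + by move=> y _; rewrite -EFinD lee_fin.
  - by move=> y _; rewrite lee_fin.
  - exact/measurable_EFinP.
  - by move=> y _; rewrite lee_fin.
  - exact/measurable_EFinP.
have k0 y : 0 <= K * h / 2 * phi2 y by rewrite !mulr_ge0// ltW.
have mk : measurable_fun setT (fun y => K * h / 2 * phi2 y) by exact: measurable_funM.
have hk0 y : 0 <= h ^+ 2 / 4 * (K * h / 2 * phi2 y).
  by rewrite mulr_ge0// divr_ge0// sqr_ge0.
have mhk : measurable_fun setT (fun y => h ^+ 2 / 4 * (K * h / 2 * phi2 y)).
  exact: measurable_funM.
have Hlip y : `|H y * phi y - H y * phi (c y)| <= h ^+ 2 / 4 * (K * h / 2 * phi2 y).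
  by rewrite -mulrBr normrM ger0_norm// ler_pM.
have J1 := intle _ _ _ (fun y => phi0 (c y)) phi0 k0 mphic mphi mk.
have J2 := intle _ _ _ phi0 (fun y => phi0 (c y)) k0 mphi mphic mk.
have Hphi0 y : 0 <= H y * phi y by rewrite mulr_ge0.
have Hphic0 y : 0 <= H y * phi (c y) by rewrite mulr_ge0.
have mHphi : measurable_fun setT (fun y => H y * phi y) by exact: measurable_funM.
have mHphic : measurable_fun setT (fun y => H y * phi (c y)) by exact: measurable_funM.
have I1 := intle _ _ _ Hphi0 Hphic0 hk0 mHphi mHphic mhk.
have I2 := intle _ _ _ Hphic0 Hphi0 hk0 mHphic mHphi mhk.
have {}J1 : (\int[mu]_y (phi (c y))%:E <= (1 + K * h / 2)%:E)%E.
  rewrite EFinD -intK -[1%E](integral_normal_pdf 0 s); apply: J1 => y.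
  by have := lip y; rewrite ler_norml => /andP[+ _]; rewrite /=; lra.
have {}J2 : (1 <= \int[mu]_y (phi (c y))%:E + (K * h / 2)%:E)%E.
  rewrite -intK -[1%E](integral_normal_pdf 0 s); apply: J2 => y.
  by have := lip y; rewrite ler_norml => /andP[_ +]; rewrite /=; lra.
have {}I1 : (\int[mu]_y (H y * phi y)%:E <=
    (h ^+ 2 / 12)%:E * \int[mu]_y (phi (c y))%:E + (K * h ^+ 3 / 8)%:E)%E.
  rewrite -Hphic -intK4; apply: I1 => y.
  by have := Hlip y; rewrite ler_norml => /andP[_ +]; rewrite /=; lra.
have {}I2 : ((h ^+ 2 / 12)%:E * \int[mu]_y (phi (c y))%:E <=
    \int[mu]_y (H y * phi y)%:E + (K * h ^+ 3 / 8)%:E)%E.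
  rewrite -Hphic -intK4; apply: I2 => y.
  by have := Hlip y; rewrite ler_norml => /andP[+ _]; rewrite /=; lra.
rewrite ge0_integral_normal_prob; last 2 first.
- exact/measurable_EFinP.
- by move=> y; rewrite lee_fin H0.
rewrite (_ : (\int[mu]_y _)%E = (\int[mu]_y (H y * phi y)%:E)%E)//.
have : (\int[mu]_y (phi (c y))%:E)%E \is a fin_num.
  by rewrite ge0_fin_numE ?(le_lt_trans J1) ?ltry// integral_ge0// => y _; rewrite lee_fin.
move: J1 J2 I1 I2; case: (\int[mu]_y (phi (c y))%:E)%E => // J.
rewrite -EFinM -!EFinD !lee_fin => J1 J2 I1.
have : (\int[mu]_y (H y * phi y)%:E)%E \is a fin_num.
  by rewrite ge0_fin_numE ?(le_lt_trans I1) ?ltry// integral_ge0// => y _; rewrite lee_fin.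
move: I1; case: (\int[mu]_y (H y * phi y)%:E)%E => // I.
rewrite -!EFinD !lee_fin => I1 _ I2.
have h2 : 0 < h ^+ 2 by rewrite exprn_gt0.
have Kh3 : 0 <= K * h ^+ 3 by rewrite mulr_ge0 ?exprn_ge0// ltW.
have J1' : h ^+ 2 / 12 * J <= h ^+ 2 / 12 + K * h ^+ 3 / 24.
  have : h ^+ 2 / 12 * J <= h ^+ 2 / 12 * (1 + K * h / 2).
    by rewrite ler_wpM2l// divr_ge0// ltW.
  by congr (_ <= _); field.
have J2' : h ^+ 2 / 12 - K * h ^+ 3 / 24 <= h ^+ 2 / 12 * J.
  have : h ^+ 2 / 12 * (1 - K * h / 2) <= h ^+ 2 / 12 * J.
    rewrite ler_wpM2l//; first by rewrite divr_ge0// ltW.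
    by move: J2; rewrite -lerBlDr.
  by congr (_ <= _); field.
by move=> _; apply/andP; split; move: Kh3 J1' J2' I1 I2; lra.
Qed.

End uniform_quantization_error.

(** * Independence of the entries visited earlier *)

Section past.
Context {d} {T : measurableType d} {R : realType} (P : probability T R).
Context {I : finType} (X : I -> {RV P >-> R}).
Implicit Types (ks : seq I) (k : I).

(** Cylinders over the variables in [ks]: a class closed under intersection, containing the whole
    space, on which independence can be tested. *)
Definition past_gen (ks : seq I) : set (set T) :=
  [set \bigcap_(i in [set` ks]) X i @^-1` E i |
    E in [set E : I -> set R | forall i, measurable (E i)]].

Notation past ks := (g_sigma_algebraType (past_gen ks)).

Lemma past_gen_measurable ks : past_gen ks `<=` measurable.
Proof.
move=> _ [E mE <-]; apply: fin_bigcap_measurable; first exact: finite_seq.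
by move=> i _; exact: measurable_funPTI.
Qed.

Lemma past_measurable ks (A : set (past ks)) : measurable A ->
  measurable (A : set T).
Proof.
by apply: smallest_sub; [exact: sigma_algebra_measurable|exact: past_gen_measurable].
Qed.

Lemma past_gen_setI ks : setI_closed (past_gen ks).
Proof.
move=> _ _ [E mE <-] [F mF <-]; exists (fun i => E i `&` F i).
  by move=> i; exact: measurableI.
by rewrite -bigcapI; apply: eq_bigcapr => i _; rewrite preimage_setI.
Qed.

Lemma past_gen_setT ks : past_gen ks setT.
Proof.
exists (fun=> setT) => //.
by apply/seteqP; split => // w _ i _.
Qed.

Lemma past_gen_sub ks ks' : {subset ks <= ks'} -> past_gen ks `<=` past_gen ks'.
Proof.
move=> kk' _ [E mE <-]; exists (fun i => if i \in ks then E i else setT).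
  by move=> i; case: ifP.
apply/seteqP; split => w /= H i /= ik; last by case: ifP => // /H.
by have := H i (kk' _ ik); rewrite ik.
Qed.

Lemma measurable_past_sub ks ks' d' (T' : measurableType d') (f : T -> T') :
  {subset ks <= ks'} -> measurable_fun [set: past ks] f ->
  measurable_fun [set: past ks'] f.
Proof.
move=> kk' mf _ E mE; rewrite setTI.
have := mf measurableT E mE; rewrite setTI.
by apply: sub_smallest2r; [exact: smallest_sigma_algebra|exact: past_gen_sub].
Qed.

Lemma measurable_past_RV ks k : k \in ks -> measurable_fun [set: past ks] (X k).
Proof.
move=> kks _ E mE; rewrite setTI; apply: sub_sigma_algebra.
exists (fun i => if i == k then E else setT); first by move=> i; case: ifP.
apply/seteqP; split => w /=; first by move/(_ k kks); rewrite eqxx.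
by move=> Xk i _ /=; case: eqP => // ->.
Qed.

Hypothesis indep : mutually_independent X.

Let indep_bigcap (ks : seq I) (k : I) (E : I -> set R) (F : set R) : k \notin ks ->
  (forall i, measurable (E i)) -> measurable F ->
  P ((\bigcap_(i in [set` ks]) X i @^-1` E i) `&` X k @^-1` F) =
  (P (\bigcap_(i in [set` ks]) X i @^-1` E i)%classic * P (X k @^-1` F))%E.
Proof.
move=> kks mE mF; pose J := [set i in ks]%SET.
have JE : [set` ks] = [set` J].
  by apply/seteqP; split => i /=; rewrite inE.
have kJ : k \notin J by rewrite inE.
pose E' i := if i == k then F else E i.
have E'E i : i \in J -> E' i = E i.
  by rewrite /E' => iJ; case: eqP iJ kJ => // -> ->.
have mE' i : measurable (E' i) by rewrite /E'; case: ifP.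
have := indep (k |: J)%SET E' mE'; rewrite big_setU1//= {2}/E' eqxx.
rewrite (eq_bigr (fun i => P (X i @^-1` E i))); last by move=> i /E'E ->.
move=> H; rewrite JE indep// muleC -{}H; congr (P _).
apply/seteqP; split => w /=.
  move=> [H XF] i /=; rewrite !inE => /orP[/eqP->|iks].
    by rewrite /E' eqxx.
  by rewrite E'E ?inE//; apply: H; rewrite /= inE.
move=> H; split; last first.
  by have /= := H k; rewrite !inE eqxx => /(_ isT); rewrite /E' eqxx.
by move=> i /= iJ; have := H i; rewrite /= in_setU1 iJ orbT E'E// => /(_ isT).
Qed.

(** As functions of [A] both sides are finite measures, a restriction and a multiple of [P]. They
    agree on the generating cylinders, hence on the generated sigma-algebra. *)
Lemma past_indep ks k (A : set (past ks)) (F : set R) : k \notin ks ->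
  measurable A -> measurable F ->
  P ((A : set T) `&` X k @^-1` F) = (P (A : set T) * P (X k @^-1` F))%E.
Proof.
move=> kks mA mF; have mXF : measurable (X k @^-1` F) by exact: measurable_funPTI.
have PXF : P (X k @^-1` F) \is a fin_num by rewrite fin_num_measure.
pose c := fine (P (X k @^-1` F)); have c0 : 0 <= c by rewrite fine_ge0.
rewrite -(fineK PXF) -/c muleC.
apply: (@g_sigma_algebra_measure_unique _ R T (past_gen ks)
  (@past_gen_measurable ks) (fun=> setT) (fun=> past_gen_setT ks) _
  (mrestr P mXF) (mscale (NngNum c0) P) (@past_gen_setI ks)) => //.
- by rewrite bigcup_const.
- move=> _ [E mE <-]; set B := \bigcap_(i in _) _.
  suff : P (B `&` X k @^-1` F) = (c%:E * P B)%E by [].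
  by rewrite indep_bigcap// -(fineK PXF) -/c muleC.
- move=> _; suff : (P ([set: T] `&` X k @^-1` F) < +oo)%E by [].
  by rewrite setTI ltey_eq PXF.
Qed.

(* Conditioning on the past of [X k]: the law of [X k] is frozen while the
   variables visited earlier are integrated afterwards. *)
Lemma ge0_integral_past ks k (f : past ks * R -> \bar R) :
  k \notin ks -> measurable_fun setT f -> (forall z, (0 <= f z)%E) ->
  (\int[P]_w f (w, X k w) =
   \int[P]_w \int[distribution P (X k)]_y f (w, y))%E.
Proof.
move=> kks mf f0.
(* The past is the identity into the coarser sigma-algebra. By independence the joint law of the
   past and [X k] is the product of their laws, and Tonelli's theorem applies. *)
have mY : measurable_fun [set: T] (id : T -> past ks).
  by move=> _ A mA; rewrite setTI; exact: (past_measurable ks A mA).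
pose Y : {mfun T >-> past ks} := mfun_Sub (mem_set mY).
have mXk : measurable_fun [set: T] (X k) by exact: measurable_funPT.
have mYX : measurable_fun [set: T] (fun w => (Y w, X k w)).
  by apply/measurable_fun_pairP; split.
pose YX : {mfun T >-> (past ks * R)%type} := mfun_Sub (mem_set mYX).
have mE := @product_measure_unique _ _ _ _ _ (distribution P Y)
  (distribution P (X k)) (distribution P YX).
transitivity (\int[distribution P YX]_z f z)%E.
  by rewrite ge0_integral_distribution.
transitivity (\int[(distribution P Y \x distribution P (X k))%E]_z f z)%E.
  apply: eq_measure_integral => A mA _; apply/esym/mE => // B F mB mF.
  exact: (past_indep ks k B F kks mB mF).
rewrite fubini_tonelli1//.
apply: (@ge0_integral_distribution _ _ _ _ R P Y (fubini_F (distribution P (X k)) f)).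
  exact: measurable_fun_fubini_tonelli_F.
by move=> w; apply: integral_ge0.
Qed.

End past.

(** * Gaussian inputs: mean squared errors and cell probabilities *)

Section gaussian_sequential_rounding.
Context {d} {T : measurableType d} {R : realType} (P : probability T R).
Context {I : finType} (X : I -> {RV P >-> R}).
Variables (round : R -> int) (s : I -> R) (U : I -> I -> R) (sigma : R).
Hypothesis round_nearest : is_nearest_int round.
Hypothesis s_gt0 : forall k, 0 < s k.
Hypothesis sigma_gt0 : 0 < sigma.
Hypothesis X_normal : iid_normal sigma X.
Implicit Types (ks : seq I) (k : I).

Notation past ks := (g_sigma_algebraType (past_gen P X ks)).
Notation driftX ks l := (fun w => drift round s U ks (X^~ w) l).

Lemma measurable_quant_err d' (T' : measurableType d') k (f : T' -> R) :
  measurable_fun setT f -> measurable_fun setT (fun x => quant_err round s k (f x)).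
Proof.
move=> mf; apply: measurable_funB => //; apply: measurable_funM => //.
apply: (measurable_fun_round round round_nearest _ _ (fun x => f x / s k)).
exact: measurable_funM.
Qed.

Lemma sub_cons k ks : {subset ks <= k :: ks}.
Proof. by move=> i iks; rewrite inE iks orbT. Qed.

Lemma measurable_drift ks l : measurable_fun [set: past ks] (driftX ks l).
Proof.
elim: ks l => [|k ks IH] l /=; first exact: measurable_cst.
have IHk l' := measurable_past_sub P X ks (k :: ks) _ R _ (sub_cons k ks) (IH l').
apply: measurable_funD; first exact: IHk.
apply: measurable_funM; last exact: measurable_cst.
apply: measurable_quant_err; apply: measurable_funD; last exact: IHk.
by apply: measurable_past_RV; rewrite inE eqxx.
Qed.

Lemma measurable_past_fun ks d' (T' : measurableType d') (f : T -> T') :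
  measurable_fun [set: past ks] f -> measurable_fun [set: T] f.
Proof.
move=> mf _ E mE; have := mf measurableT E mE; rewrite !setTI.
exact: past_measurable.
Qed.

(* [R] and [measurableTypeR R] carry the same measurable sets under different
   displays, whence the detour through the identity map. *)
Lemma integral_law k (f : R -> \bar R) :
  measurable_fun [set: R] f -> (forall y, (0 <= f y)%E) ->
  (\int[distribution P (X k)]_y f y = \int[normal_prob 0 sigma]_y f y)%E.
Proof.
move=> mf f0.
have mid : measurable_fun [set: measurableTypeR R] (id : measurableTypeR R -> R).
  by move=> _ A mA; rewrite setTI.
pose J : {mfun measurableTypeR R >-> R} :=
  @mfun_Sub _ _ (measurableTypeR R) R id (mem_set mid).
transitivity (\int[distribution (normal_prob 0 sigma) J]_y f y)%E.
  by apply: eq_measure_integral => A mA _; exact: X_normal.1.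
exact: (@ge0_integral_distribution _ _ _ _ R (normal_prob 0 sigma) J f mf f0).
Qed.

Lemma ge0_integral_past_normal ks k (f : past ks * R -> \bar R) :
  k \notin ks -> measurable_fun setT f -> (forall z, (0 <= f z)%E) ->
  (\int[P]_w f (w, X k w) = \int[P]_w \int[normal_prob 0 sigma]_y f (w, y))%E.
Proof.
move=> kks mf f0; rewrite (ge0_integral_past P X X_normal.2)//.
apply: eq_integral => w _; rewrite integral_law//.
exact: measurable_fun_pair2 mf.
Qed.

Lemma measurable_past_inner ks k (f : past ks * R -> \bar R) :
  measurable_fun setT f -> (forall z, (0 <= f z)%E) ->
  measurable_fun [set: T] (fun w => \int[normal_prob 0 sigma]_y f (w, y))%E.
Proof.
move=> mf f0; apply: (measurable_past_fun ks).
have -> : (fun w : past ks => \int[normal_prob 0 sigma]_y f (w, y))%E =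
    fubini_F (distribution P (X k)) f.
  apply/funext => w; rewrite /fubini_F integral_law//.
  exact: measurable_fun_pair2 mf.
exact: measurable_fun_fubini_tonelli_F.
Qed.

Variable K : R.
Hypothesis HK : forall h a : R, 0 < h <= 1 ->
  ((h ^+ 2 / 12 - K * h ^+ 3)%:E <=
   \int[normal_prob 0 sigma]_y ((quant_err round (fun=> h) tt (y + a)) ^+ 2)%:E <=
   (h ^+ 2 / 12 + K * h ^+ 3)%:E)%E.

Lemma integral_quant_err_sqr ks k : k \notin ks -> s k <= 1 ->
  (((s k) ^+ 2 / 12 - K * s k ^+ 3)%:E <=
   \int[P]_w ((quant_err round s k (X k w + driftX ks k w)) ^+ 2)%:E <=
   ((s k) ^+ 2 / 12 + K * s k ^+ 3)%:E)%E.
Proof.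
move=> kks sk1.
pose f (z : past ks * R) : \bar R :=
  ((quant_err round s k (z.2 + driftX ks k z.1)) ^+ 2)%:E.
have f0 z : (0 <= f z)%E by rewrite lee_fin sqr_ge0.
have mf : measurable_fun setT f.
  apply/measurable_EFinP; apply: measurable_funX; apply: measurable_quant_err.
  apply: measurable_funD => //.
  by apply: (@measurableT_comp _ _ _ _ _ _ (driftX ks k : past ks -> R));
    [exact: measurable_drift|exact: measurable_fst].
rewrite (ge0_integral_past_normal ks k f)//.
have inner w := HK (s k) (driftX ks k w) (introT andP (conj (s_gt0 k) sk1)).
have min := measurable_past_inner ks k f mf f0.
apply/andP; split.
- pose a := s k ^+ 2 / 12 - K * s k ^+ 3.
  (* The lower bound may be negative; its positive part is still below the inner integral and keeps
     the comparison among nonnegative functions. *)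
  apply: (@le_trans _ _ (Num.max a 0)%:E); first by rewrite lee_fin le_max lexx.
  rewrite -[leLHS]mule1 -(probability_setT P) -integral_cst//.
  apply: ge0_le_integral => //.
  + by move=> w _; rewrite lee_fin le_max lexx orbT.
  + move=> w _; rewrite EFin_max ge_max; apply/andP; split.
      by have /andP[] := inner w.
    by apply: integral_ge0.
- rewrite -[leRHS]mule1 -(probability_setT P) -integral_cst//.
  apply: ge0_le_integral => //.
  + by move=> w _; apply: integral_ge0.
  + by move=> w _; have /andP[] := inner w.
Qed.

(** Later visits do not alter the recorded error at [k], so they are peeled off until the visit of
    [k] heads the list. *)
Lemma integral_err_sqr ks k : uniq ks -> k \in ks -> s k <= 1 ->
  (((s k) ^+ 2 / 12 - K * s k ^+ 3)%:E <=
   \int[P]_w ((err round s U ks (X^~ w) k) ^+ 2)%:E <=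
   ((s k) ^+ 2 / 12 + K * s k ^+ 3)%:E)%E.
Proof.
elim: ks => //= k' ks IH /andP[k'ks uks]; rewrite inE.
by case: (eqVneq k k') => [->|_] //= ks1 sk1; [exact: integral_quant_err_sqr|exact: IH].
Qed.

Lemma measurable_err ks k :
  measurable_fun [set: T] (fun w => err round s U ks (X^~ w) k).
Proof.
elim: ks => [|k' ks IH] /=; first exact: measurable_cst.
case: (k == k') => //; apply: measurable_quant_err; apply: measurable_funD.
  exact: measurable_funPT.
exact: (measurable_past_fun ks _ _ _ (measurable_drift ks k')).
Qed.

Lemma measurable_code ks k :
  measurable_fun [set: past ks] (fun w => (quant_code round s U ks (X^~ w) k)%:~R : R).
Proof.
elim: ks => [|k' ks IH] /=; first exact: measurable_cst.
case: (k == k').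
  apply: (measurable_fun_round round round_nearest _ (past (k' :: ks))
    (fun w => (X k' w + drift round s U ks (X^~ w) k') / s k')).
  apply: measurable_funM => //; apply: measurable_funD.
    by apply: measurable_past_RV; rewrite inE eqxx.
  exact: (measurable_past_sub P X ks (k' :: ks) _ R _ (sub_cons k' ks) (measurable_drift ks k')).
exact: (measurable_past_sub P X ks (k' :: ks) _ R _ (sub_cons k' ks) IH).
Qed.

Definition code_cell ks (z : I -> int) : set T :=
  [set w | forall k, k \in ks -> quant_code round s U ks (X^~ w) k = z k].

Lemma measurable_code_cell ks z : measurable (code_cell ks z : set (past ks)).
Proof.
have -> : code_cell ks z = \bigcap_(k in [set` ks])
    ((fun w => (quant_code round s U ks (X^~ w) k)%:~R : R) @^-1` [set (z k)%:~R]).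
  apply/seteqP; split => w H k kks; first by rewrite /= H.
  by apply/eqP; have /eqP := H k kks; rewrite /= eqr_int.
apply: fin_bigcap_measurable; first exact: finite_seq.
move=> k _; rewrite -[X in measurable X]setTI.
exact: measurable_code.
Qed.

(** A new visit keeps the older codes and cuts the cell by one rounding condition whose shift
    depends on the past only. *)
Lemma code_cell_cons k ks z : k \notin ks -> code_cell (k :: ks) z =
  code_cell ks z `&`
  [set w | round ((X k w + drift round s U ks (X^~ w) k) / s k) = z k].
Proof.
move=> kks; apply/seteqP; split => [w H|w [H Hk] i /=].
  split=> [i iks|]; last by have := H k; rewrite /= inE eqxx; exact.
  have := H i; rewrite /= inE iks orbT => <-//.
  by case: eqP iks kks => // -> ->.
by rewrite inE; case: eqP => [->|_ /=]; [move=> _|exact: H].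
Qed.

(** Half a step for the rounding at [k] plus the worst total drift: a bound on the distance from an
    input to its decoded value. *)
Definition cell_radius k : R := s k / 2 + \sum_j s j / 2 * `|U j k|.

Lemma cell_radius_ge0 k : 0 <= cell_radius k.
Proof.
apply: addr_ge0; first by rewrite divr_ge0// ltW.
by apply: sumr_ge0 => j _; rewrite mulr_ge0// divr_ge0// ltW.
Qed.

Lemma drift_le_radius ks w k : uniq ks ->
  `|drift round s U ks w k| <= cell_radius k - s k / 2.
Proof.
move=> uks; rewrite addrAC subrr add0r.
apply: le_trans (drift_le round s U round_nearest s_gt0 ks w k) _.
rewrite big_uniq//= [leRHS](bigID (mem ks))/= lerDl sumr_ge0// => j _.
by rewrite mulr_ge0// divr_ge0// ltW.
Qed.

(** Induction on the visits: with the past frozen, the newest coordinate ranges over a set of length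
    [s k] within [cell_radius k] of its decoded value. Its conditional probability is thus between
    [m k * s k] and [M k * s k], whatever the past. *)
Lemma code_cell_prob ks z (m M : I -> R) : uniq ks ->
  (forall k, 0 <= m k) ->
  (forall k y, `|y - s k * (z k)%:~R| <= cell_radius k ->
    m k <= normal_pdf 0 sigma y <= M k) ->
  ((\prod_(k <- ks) (m k * s k))%:E <= P (code_cell ks z) <=
   (\prod_(k <- ks) (M k * s k))%:E)%E.
Proof.
move=> + m0 mM; elim: ks => [_|k ks IH /=].
  rewrite !big_nil (_ : code_cell _ _ = setT) ?probability_setT ?lexx//.
  by apply/seteqP; split => // w _ k.
case/andP=> kks uks; have {IH}/andP[IHm IHM] := IH uks; rewrite !big_cons.
set C := code_cell ks z in IHm IHM *.
pose g (q : past ks * R) : R := (q.2 + drift round s U ks (X^~ q.1) k) / s k.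
have mg : measurable_fun setT g.
  apply: measurable_funM => //; apply: measurable_funD => //.
  by apply: (@measurableT_comp _ _ _ _ _ _ (driftX ks k : past ks -> R));
    [exact: measurable_drift|exact: measurable_fst].
pose D : set (past ks * R) := (fst @^-1` (C : set (past ks))) `&` ((round \o g) @^-1` [set z k]).
have mD : measurable D.
  apply: measurableI; last exact: measurable_round_comp.
  rewrite -[X in measurable X]setTI; apply: measurable_fst => //.
  exact: measurable_code_cell.
pose f (q : past ks * R) : \bar R := (\1_D q)%:E.
have f0 q : (0 <= f q)%E by rewrite lee_fin.
have mf : measurable_fun setT f by apply/measurable_EFinP; exact: measurable_indic.
have mC : measurable (C : set T).
  exact: (past_measurable P X ks _ (measurable_code_cell ks z)).
have mC' : measurable (code_cell (k :: ks) z : set T).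
  exact: (past_measurable P X (k :: ks) _ (measurable_code_cell _ z)).
have PE : P (code_cell (k :: ks) z) = (\int[P]_w f (w, X k w))%E.
  rewrite -[X in P X]setIT -integral_indic//; apply: eq_integral => w _.
  by rewrite /f code_cell_cons.
have min := measurable_past_inner ks k f mf f0.
rewrite PE (ge0_integral_past_normal ks k f)//.
pose Ck w := (fun y => round ((y + drift round s U ks (X^~ w) k) / s k)) @^-1` [set z k].
have mCk w : measurable (Ck w : set (measurableTypeR R)) by exact: measurable_cell.
have inner w : (\int[normal_prob 0 sigma]_y f (w, y))%E =
    ((\1_C w)%:E * normal_prob 0 sigma (Ck w))%E.
  have -> : normal_prob 0 sigma (Ck w) = (\int[normal_prob 0 sigma]_y (\1_(Ck w) y)%:E)%E.
    by rewrite integral_indic// setIT.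
  rewrite -ge0_integralZl_EFin//; last first.
  - by apply/measurable_EFinP; exact: measurable_indic.
  apply: eq_integral => y _; rewrite /f -EFinM; congr _%:E.
  by rewrite /D indicI.
have Cky w y : Ck w y -> `|y - s k * (z k)%:~R| <= cell_radius k.
  move=> Cy.
  have := cell_sup round round_nearest (s k) (drift round s U ks (X^~ w) k) (z k) (s_gt0 k) y Cy.
  rewrite /= in_itv/=; have := drift_le_radius ks (X^~ w) k uks.
  rewrite !ler_norml => /andP[]; set a := drift _ _ _ _ _ _ => a1 a2 /andP[y1 y2].
  by apply/andP; split; lra.
have Ms0 : 0 <= M k * s k.
  rewrite mulr_ge0//; last exact: ltW.
  have := mM k (s k * (z k)%:~R); rewrite subrr normr0 => /(_ _)/andP[|_].
    exact: cell_radius_ge0.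
  exact: le_trans (normal_pdf_ge0 _ _ _).
have lebCk w := lebesgue_measure_cell round round_nearest (s k)
  (drift round s U ks (X^~ w) k) (z k) (s_gt0 k).
apply/andP; split.
- apply: (@le_trans _ _ ((m k * s k)%:E * P C)%E).
    by rewrite EFinM lee_wpmul2l// lee_fin mulr_ge0// ltW.
  rewrite -[X in P X]setIT -integral_indic// -ge0_integralZl_EFin//; last 2 first.
  - by apply/measurable_EFinP; exact: measurable_indic.
  - by rewrite mulr_ge0// ltW.
  apply: ge0_le_integral => //.
  + by move=> w _; rewrite mule_ge0 ?lee_fin ?mulr_ge0// ltW.
  + by apply: emeasurable_funM => //; apply/measurable_EFinP; exact: measurable_indic.
  + move=> w _; rewrite inner muleC lee_wpmul2l ?lee_fin//.
    by apply: (normal_prob_ge sigma _ _ _ (mCk w) (lebCk w)) => // y /Cky /mM /andP[].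
- apply: (@le_trans _ _ ((M k * s k)%:E * P C)%E); last first.
    by rewrite [X in (_ <= X)%E]EFinM lee_wpmul2l// lee_fin.
  rewrite -[X in P X]setIT -integral_indic// -ge0_integralZl_EFin//; last first.
  - by apply/measurable_EFinP; exact: measurable_indic.
  apply: ge0_le_integral => //.
  + by move=> w _; exact: integral_ge0.
  + by apply: emeasurable_funM => //; apply/measurable_EFinP; exact: measurable_indic.
  + move=> w _; rewrite inner muleC lee_wpmul2r ?lee_fin//.
    by apply: (normal_prob_le sigma _ _ _ (mCk w) (lebCk w)) => // y /Cky /mM /andP[].
Qed.

End gaussian_sequential_rounding.

(** * Entropy of the codes *)

Section entropy_of_codes.
Context {d} {T : measurableType d} {R : realType} (P : probability T R).
Context {I : finType} (X : I -> {RV P >-> R}).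
Variables (round : R -> int) (s : I -> R) (U : I -> I -> R) (sigma : R).
Hypothesis round_nearest : is_nearest_int round.
Hypothesis s_gt0 : forall k, 0 < s k.
Hypothesis sigma_gt0 : 0 < sigma.
Hypothesis X_normal : iid_normal sigma X.
Implicit Types k : I.

Lemma integral_sqr_RV k : (\int[P]_w (X k w ^+ 2)%:E = (sigma ^+ 2)%:E)%E.
Proof.
have msqr : measurable_fun [set: R] (fun y : R => (y ^+ 2)%:E).
  by apply/measurable_EFinP; exact: measurable_funX.
have sqr0 (y : R) : (0 <= (y ^+ 2)%:E)%E by rewrite lee_fin sqr_ge0.
have <- := ge0_integral_distribution (X k) msqr sqr0.
by rewrite (integral_law P X sigma X_normal)// integral_sqr_normal_prob.
Qed.

Lemma integrable_sqr_RV k : P.-integrable setT (fun w => (X k w ^+ 2)%:E).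
Proof.
apply/integrableP; split.
  by apply/measurable_EFinP; apply: measurable_funX; exact: measurable_funPT.
under eq_integral do rewrite gee0_abs ?lee_fin ?sqr_ge0//.
by rewrite integral_sqr_RV ltry.
Qed.

Let summand_integrable (a b : I -> R) k :
  P.-integrable setT (fun w => ((a k)%:E + (b k)%:E * (X k w ^+ 2)%:E)%E).
Proof.
apply: integrableD => //; first exact: finite_measure_integrable_cst.
by apply: integrableZl => //; exact: integrable_sqr_RV.
Qed.

Lemma integrable_quadratic (a b : I -> R) :
  P.-integrable setT (fun w => (\sum_k (a k + b k * X k w ^+ 2))%:E).
Proof.
under eq_fun do rewrite -sumEFin.
by apply: integrable_sum => // k _; exact: summand_integrable.
Qed.

Lemma integral_quadratic (a b : I -> R) :
  (\int[P]_w (\sum_k (a k + b k * X k w ^+ 2))%:E =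
   (\sum_k (a k + b k * sigma ^+ 2))%:E)%E.
Proof.
under eq_integral do rewrite -sumEFin.
rewrite integral_sum//; last by move=> k; exact: summand_integrable.
rewrite -sumEFin; apply: eq_bigr => k _; rewrite EFinD EFinM.
under eq_integral do rewrite EFinD EFinM.
rewrite integralD//; last 2 first.
- exact: finite_measure_integrable_cst.
- by apply: integrableZl => //; exact: integrable_sqr_RV.
rewrite integralZl//; last exact: integrable_sqr_RV.
rewrite integral_sqr_RV; congr (_ + _)%E.
by rewrite -[RHS]mule1 -(probability_setT P) -integral_cst.
Qed.

Variable ks : seq I.
Hypothesis ks_uniq : uniq ks.
Hypothesis ks_full : forall k, k \in ks.
Hypothesis U_diag : forall k, U k k = 1.
Hypothesis U_tri : pairwise (fun k l => U k l == 0) ks.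

Context {S : countType} (Z : T -> S) (zc : S -> I -> int).
Hypothesis ZE : forall z, Z @^-1` [set z] = code_cell P X round s U ks (zc z).

Let rad := cell_radius s U.
Let rad_ge0 k : 0 <= rad k. Proof. exact: cell_radius_ge0. Qed.
Let pr z : R := fine (P (Z @^-1` [set z])).

Let s2 : 0 < sigma ^+ 2. Proof. by rewrite exprn_gt0. Qed.

Let mfiber z : measurable (Z @^-1` [set z]).
Proof.
rewrite ZE; apply: (past_measurable P X ks).
exact: measurable_code_cell.
Qed.

Definition log_density (x : R) : R :=
  ln (normal_peak sigma) - x ^+ 2 / (2 * sigma ^+ 2).

(** Bounds the variation of [log_density] over a cell around [x]. The growth, linear in |x|, is
    relaxed by |x| <= 1 + x^2, so that the expectation needs the second moment only. *)
Definition log_slack k (x : R) : R := 2 * rad k * (1 + rad k + x ^+ 2) / sigma ^+ 2.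

Let log_densityE (x : R) : normal_pdf 0 sigma x = expR (log_density x).
Proof.
rewrite normal_pdfE ?gt_eqF// /normal_fun subr0 /log_density expRD lnK; last first.
  by rewrite posrE normal_peak_gt0 ?gt_eqF.
by rewrite mulNr -mulr_natl.
Qed.

Let log_density_near k (x y c : R) : `|x - c| <= rad k -> `|y - c| <= rad k ->
  `|log_density y - log_density x| <= log_slack k x.
Proof.
move=> xc yc; rewrite /log_density /log_slack; set r := rad k in xc yc *.
have r0 : 0 <= r := rad_ge0 k.
have -> : ln (normal_peak sigma) - y ^+ 2 / (2 * sigma ^+ 2) -
    (ln (normal_peak sigma) - x ^+ 2 / (2 * sigma ^+ 2)) =
    (x - y) * (x + y) / (2 * sigma ^+ 2) by field; rewrite gt_eqF.
rewrite normrM [X in _ * X]gtr0_norm ?invr_gt0 ?mulr_gt0// normrM.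
have xy : `|x - y| <= 2 * r.
  have := ler_distD c x y; rewrite (distrC c); move: xc yc; lra.
have xpy : `|x + y| <= 2 * `|x| + 2 * r.
  have -> : x + y = 2 * x - (x - y) by ring.
  by apply: le_trans (ler_normB _ _) _; rewrite normrM ger0_norm// lerD2l.
have x2 : `|x| <= 1 + x ^+ 2.
  rewrite -(real_normK (num_real x)); have := sqr_ge0 (`|x| - 1).
  have := normr_ge0 x; nra.
apply: (@le_trans _ _ (2 * r * (2 * (1 + r + x ^+ 2)) / (2 * sigma ^+ 2))).
  rewrite ler_pM2r ?invr_gt0 ?mulr_gt0// ler_pM//.
  apply: le_trans xpy _; move: x2; lra.
by rewrite le_eqVlt; apply/orP; left; apply/eqP; field; rewrite gt_eqF.
Qed.

Let total_log_density w := \sum_k (ln (s k) + log_density (X k w)).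
Let total_slack w := \sum_k log_slack k (X k w).

Let sum_ks (f : I -> R) : \sum_(k <- ks) f k = \sum_k f k.
Proof.
apply: perm_big; apply: uniq_perm; rewrite ?index_enum_uniq// => k.
by rewrite ks_full mem_index_enum.
Qed.

(** The sample lies in its own cell, close to the decoded value. The density bounds over the cell
    can therefore be expressed at the sample, which makes them integrable in [w]. *)
Lemma log_prob_bounds w : 0 < pr (Z w) /\
  `|ln (pr (Z w)) - total_log_density w| <= total_slack w.
Proof.
have wZ : code_cell P X round s U ks (zc (Z w)) w by rewrite -ZE.
have near k : `|X k w - s k * (zc (Z w) k)%:~R| <= rad k.
  rewrite -(wZ k (ks_full k)) -drift_code// opprD addrA subrr sub0r normrN.
  apply: le_trans (drift_le_radius _ _ _ round_nearest s_gt0 _ _ _ ks_uniq) _.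
  by rewrite gerBl divr_ge0// ltW.
pose b (sg : R) k := expR (log_density (X k w) + sg * log_slack k (X k w)).
have := code_cell_prob P X round s U sigma round_nearest s_gt0 X_normal
  ks (zc (Z w)) (b (-1)) (b 1) ks_uniq (fun k => expR_ge0 _).
have prodE sg : \prod_(k <- ks) (b sg k * s k) =
    expR (total_log_density w + sg * total_slack w).
  rewrite /total_log_density /total_slack mulr_sumr -big_split/= -sum_ks expR_sum.
  apply: eq_bigr => k _; rewrite /b !(expRD _ (sg * _)) [expR (ln _ + _)]expRD.
  by rewrite lnK ?posrE// mulrC mulrA.
rewrite !prodE -ZE => /(_ _)/andP[k y yz|].
  have := log_density_near k _ _ _ (near k) yz; rewrite ler_distl => /andP[L1 L2].
  by rewrite !log_densityE !ler_expR; apply/andP; split; lra.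
rewrite /pr; have : P (Z @^-1` [set Z w]) \is a fin_num by rewrite fin_num_measure.
case: (P _) => // p _ /=; rewrite !lee_fin => p1 p2.
have p0 : 0 < p by apply: lt_le_trans p1; exact: expR_gt0.
split => //; move: p1 p2; rewrite -(lnK p0 : expR (ln p) = p) !ler_expR lnK//.
by rewrite ler_distl => p1 p2; apply/andP; split; lra.
Qed.

(** Entropy is the expectation of -log2 of the probability of the observed code. In nats this
    variable lies between g - h and g + h, both quadratic in the inputs; the term 1/2 is the
    expectation of x^2 / (2 sigma^2). *)
Lemma entropy_code : exists2 e : R,
  `|e| <= \sum_k (2 * rad k * (1 + rad k + sigma ^+ 2) / sigma ^+ 2) &
  entropy P Z =
    ((\sum_k (2^-1 - ln (s k) - ln (normal_peak sigma)) + e) / ln 2)%:E.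
Proof.
pose l w : R := - ln (pr (Z w)).
have ml : measurable_fun [set: T] l.
  move=> _ E mE; rewrite setTI.
  exact: (measurable_fibers Z mfiber ((fun z => - ln (pr z)) @^-1` E)).
have prle1 z : pr z <= 1.
  by rewrite -lee_fin fineK ?fin_num_measure// probability_le1.
have l0 w : 0 <= l w by rewrite oppr_ge0 ln_le0.
have ln2 : 0 < ln (2 : R) by rewrite ln_gt0// ltr1n.
pose g w := \sum_k (- ln (s k) - ln (normal_peak sigma) + (2 * sigma ^+ 2)^-1 * X k w ^+ 2).
pose h w := \sum_k (2 * rad k * (1 + rad k) / sigma ^+ 2 + 2 * rad k / sigma ^+ 2 * X k w ^+ 2).
have gE w : g w = - total_log_density w.
  rewrite /g /total_log_density -sumrN; apply: eq_bigr => k _.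
  by rewrite /log_density; ring.
have hE w : h w = total_slack w.
  rewrite /h /total_slack; apply: eq_bigr => k _.
  by rewrite /log_slack; ring.
have lgh w : g w - h w <= l w <= g w + h w.
  have [_] := log_prob_bounds w; rewrite -hE ler_distl -[total_log_density w]opprK.
  by rewrite -gE /l => /andP[? ?]; apply/andP; split; lra.
have intg : P.-integrable setT (EFin \o g) by exact: integrable_quadratic.
have inth : P.-integrable setT (EFin \o h) by exact: integrable_quadratic.
have intgh : P.-integrable setT (fun w => ((g w)%:E + (h w)%:E)%E) by exact: integrableD.
have intgBh : P.-integrable setT (fun w => ((g w)%:E - (h w)%:E)%E) by exact: integrableB.
(* Domination by g + h is what makes the entropy finite although the codes range over an infinite
   set. *)
have intl : P.-integrable setT (EFin \o l).
  apply: le_integrable intgh => //; first exact/measurable_EFinP.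
  move=> w _; rewrite -EFinD !abse_EFin lee_fin ger0_norm//.
  by have /andP[_ lw] := lgh w; rewrite (le_trans lw)// ler_norm.
have Ig : (\int[P]_w (g w)%:E =
    (\sum_k (2^-1 - ln (s k) - ln (normal_peak sigma)))%:E)%E.
  rewrite integral_quadratic; congr _%:E; apply: eq_bigr => k _.
  by field; rewrite gt_eqF.
have Ih : (\int[P]_w (h w)%:E =
    (\sum_k (2 * rad k * (1 + rad k + sigma ^+ 2) / sigma ^+ 2))%:E)%E.
  rewrite integral_quadratic; congr _%:E; apply: eq_bigr => k _; ring.
have Il : entropy P Z = ((ln 2)^-1%:E * \int[P]_w (l w)%:E)%E.
  rewrite -ge0_integralZl_EFin//; last 3 first.
  - by move=> w _; rewrite lee_fin.
  - exact/measurable_EFinP.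
  - by rewrite invr_ge0 ltW.
  rewrite (ge0_integral_fibers Z mfiber)//; last 2 first.
  - by apply: emeasurable_funM => //; exact/measurable_EFinP.
  - by move=> w; rewrite mule_ge0// lee_fin// invr_ge0 ltW.
  apply: eq_esum => z _; rewrite -/(pr z).
  transitivity (\int[P]_(w in Z @^-1` [set z]) (- ln (pr z) / ln 2)%:E)%E.
    have PE : P (Z @^-1` [set z]) = (pr z)%:E by rewrite fineK ?fin_num_measure.
    rewrite integral_cst// [X in (_ * X)%E]PE -EFinM.
    by congr _%:E; rewrite /log2; ring.
  apply: eq_integral => w /set_mem wz; rewrite -EFinM /l mulrC.
  by rewrite (wz : Z w = z).
have : (\int[P]_w (l w)%:E)%E \is a fin_num by exact: integrable_fin_num.
case El : (\int[P]_w (l w)%:E)%E Il => [E| |] // EntE _.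
exists (E - \sum_k (2^-1 - ln (s k) - ln (normal_peak sigma))); last first.
  by rewrite EntE -EFinM mulrC addrCA subrr addr0.
rewrite ler_distl -!lee_fin; apply/andP; split.
- have -> : (\sum_k (2^-1 - ln (s k) - ln (normal_peak sigma)) -
      \sum_k (2 * rad k * (1 + rad k + sigma ^+ 2) / sigma ^+ 2))%:E =
      (\int[P]_w ((g w)%:E - (h w)%:E))%E by rewrite integralB_EFin// Ig Ih.
  rewrite -El; apply: le_integral => // w _.
  by rewrite -EFinB lee_fin; have /andP[] := lgh w.
- have -> : (\sum_k (2^-1 - ln (s k) - ln (normal_peak sigma)) +
      \sum_k (2 * rad k * (1 + rad k + sigma ^+ 2) / sigma ^+ 2))%:E =
      (\int[P]_w ((g w)%:E + (h w)%:E))%E by rewrite integralD// Ig Ih.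
  rewrite -El; apply: le_integral => // w _.
  by rewrite -EFinD lee_fin; have /andP[] := lgh w.
Qed.

End entropy_of_codes.

(** * Numerical value of the gap *)

Section numerical_bounds.
Context {R : realType}.
Implicit Types (x : R) (n : nat).

Lemma expR_ge_series x n : 0 <= x -> \sum_(0 <= i < n) x ^+ i / i`!%:R <= expR x.
Proof.
move=> x0; rewrite [expR x]/(limn (series (exp_coeff x))).
apply: (nondecreasing_cvgn_le (u_ := series (exp_coeff x))).
  by apply: nondecreasing_series => i _ _; exact: exp_coeff_ge0.
exact: is_cvg_series_exp_coeff.
Qed.

(* From the first term on the series is dominated by a geometric one of ratio
   1/2. *)
Lemma expR_le_series x n : 0 <= x <= 1 -> (0 < n)%N ->
  expR x <= \sum_(0 <= i < n) x ^+ i / i`!%:R + 2 * (x ^+ n / n`!%:R).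
Proof.
move=> /andP[x0 x1] n0; pose t i : R := x ^+ i / i`!%:R.
have t0 i : 0 <= t i by rewrite divr_ge0 ?exprn_ge0.
have tS i : (0 < i)%N -> t i.+1 <= t i / 2.
  move=> i0; rewrite /t factS natrM exprS invfM.
  have -> : x * x ^+ i * (i.+1%:R^-1 / i`!%:R) = (x ^+ i / i`!%:R) * (x / i.+1%:R) by ring.
  rewrite ler_wpM2l ?divr_ge0 ?exprn_ge0//.
  apply: (@le_trans _ _ (1 / i.+1%:R)); first by rewrite ler_pM2r// invr_gt0.
  by rewrite div1r lef_pV2 ?posrE// ler_nat.
have S N : \sum_(0 <= i < n + N) t i <= \sum_(0 <= i < n) t i + 2 * t n - 2 * t (n + N)%N.
  elim: N => [|N IH]; first by rewrite addn0 addrK.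
  rewrite addnS big_nat_recr//=; have := tS (n + N)%N; rewrite addn_gt0 n0 => /(_ isT).
  by move: IH; set a := t _; set b := t _; set c := \sum_(0 <= i < n + N) _; lra.
rewrite [expR x]/(limn (series (exp_coeff x))).
apply: limr_le; first exact: is_cvg_series_exp_coeff.
near=> N; have nN : (n <= N)%N by near: N; exact: nbhs_infty_ge.
rewrite /series/= -(subnKC nN); apply: le_trans (S _) _.
by rewrite gerBl mulr_ge0.
Unshelve. all: by end_near. Qed.

Lemma ln2_bounds : (693 + 1 / 10) / 1000 < ln (2 : R) < (693 + 16 / 100) / 1000.
Proof.
apply/andP; split.
- rewrite -ltr_expR lnK ?posrE//.
  apply: le_lt_trans (expR_le_series _ 8 _ _) _ => //; first by apply/andP; split; lra.
  rewrite !big_nat_recr//= big_nil !factS fact0 !natrM; lra.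
- rewrite -ltr_expR lnK ?posrE//.
  apply: lt_le_trans (expR_ge_series _ 8 _); last by lra.
  rewrite !big_nat_recr//= big_nil !factS fact0 !natrM; lra.
Qed.

(** The ratio of consecutive terms is x^2 / ((2n + 2) (2n + 1)), which is below 1 since x^2 <= 4. *)
Lemma cos_coeff'_pair x n : 0 < x <= 2 -> (0 < n)%N ->
  0 < x ^+ n.*2 / n.*2`!%:R - x ^+ n.+1.*2 / n.+1.*2`!%:R.
Proof.
move=> /andP[x0 x2] n0.
have -> : x ^+ n.+1.*2 / n.+1.*2`!%:R =
    x ^+ n.*2 / n.*2`!%:R * (x ^+ 2 / (n.*2.+2%:R * n.*2.+1%:R)).
  rewrite doubleS !factS !natrM !exprS; field.
  by apply/and3P; split; rewrite gt_eqF// ?ltr_wpDr// ltr0n fact_gt0.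
rewrite -{1}[x ^+ _ / _]mulr1 -mulrBr mulr_gt0//.
  by rewrite divr_gt0 ?exprn_gt0// ltr0n fact_gt0.
rewrite subr_gt0 ltr_pdivrMr ?mulr_gt0// mul1r.
apply: (@le_lt_trans _ _ 4); first nra.
by rewrite -natrM ltr_nat; lia.
Qed.

(** After an even number of terms the remainder is a sum of positive pairs; after an odd number, as
    in the next lemma, its opposite is. *)
Lemma cos_gt_series x n : 0 < x <= 2 -> (0 < n)%N ->
  \sum_(0 <= i < n.*2) cos_coeff' x i < cos x.
Proof.
move=> x02 n0; have h := @cvg_cos_coeff' R x.
rewrite -(cvg_lim (@Rhausdorff R) h); apply: lt_sum_lim_series; first by move/cvgP in h.
move=> k; rewrite -doubleD addnS -doubleD.
rewrite /cos_coeff' -!exprnP exprS -signr_odd odd_double expr0 mul1r mulr1 mulN1r mulNr.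
by apply: cos_coeff'_pair => //; lia.
Qed.

Lemma cos_lt_series x n : 0 < x <= 2 ->
  cos x < \sum_(0 <= i < n.*2.+1) cos_coeff' x i.
Proof.
move=> x02; have h := @cvg_cos_coeff' R x.
have hN : series (fun i => - cos_coeff' x i) @ \oo --> - cos x.
  have -> : series (fun i => - cos_coeff' x i) = (fun n => - series (cos_coeff' x) n).
    by apply/funext => k; rewrite /series/= sumrN.
  exact: cvgN.
rewrite -ltrN2 -sumrN -(cvg_lim (@Rhausdorff R) hN).
apply: lt_sum_lim_series; first by move/cvgP in hN.
move=> k; rewrite addSn -doubleD addnS addSn -doubleD.
have e1 : (-1) ^+ (n + k).*2.+1 = -1 :> R by rewrite -signr_odd /= odd_double.
have e2 : (-1) ^+ (n + k).*2.+2 = 1 :> R by rewrite -signr_odd /= odd_double.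
rewrite /cos_coeff' -!exprnP e1 e2 mulN1r mul1r mulNr opprK.
exact: cos_coeff'_pair.
Qed.

(** The cosine decreases on [0, pi] and vanishes at pi / 2, so its signs at 1.5707 and 1.571 locate
    pi / 2. *)
Lemma pi_bounds : (314 + 14 / 100) / 100 < (pi : R) < 3142 / 1000.
Proof.
have pi0 := @pi_gt0 R; have p2 := @pihalf_lt2 R.
have cos_pos x : 0 <= x <= pi -> (0 < cos x) = (x < pi / 2).
  move=> x0; rewrite -cos_pihalf ltr_cos// in_itv//=; apply/andP; split; lra.
have cos_neg x : 0 <= x <= pi -> (cos x < 0) = (pi / 2 < x).
  move=> x0; rewrite -cos_pihalf ltr_cos// in_itv//=; apply/andP; split; lra.
have p1 := @pihalf_ge1 R.
have lo : 0 < cos ((157 + 7 / 100) / 100 : R).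
  apply: lt_trans (cos_gt_series _ 3 _ _) => //; last by apply/andP; split; lra.
  rewrite /= !big_nat_recr//= big_nil /cos_coeff' -!exprnP /= !factS fact0 !natrM; lra.
have hi : cos (1571 / 1000 : R) < 0.
  apply: lt_trans (cos_lt_series _ 2 _) _; first by apply/andP; split; lra.
  rewrite /= !big_nat_recr//= big_nil /cos_coeff' -!exprnP /= !factS fact0 !natrM; lra.
apply/andP; split; rewrite ltNge; apply/negP => H.
- have I : 0 <= ((157 + 7 / 100) / 100 : R) <= pi by apply/andP; split; lra.
  by move: lo; rewrite cos_pos// ltNge => /negP; apply; lra.
- have I : 0 <= (1571 / 1000 : R) <= pi by apply/andP; split; lra.
  by move: hi; rewrite cos_neg// ltNge => /negP; apply; lra.
Qed.



Lemma half_log2_gap_bound :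
  `|2^-1 * log2 (2 * pi * expR 1 / 12) - 255 / 1000| < 1 / 2000 :> R.
Proof.
have /andP[l1 l2] := ln2_bounds; have /andP[p1 p2] := pi_bounds.
have p0 := @pi_gt0 R; have l0 : 0 < ln (2 : R) by apply: lt_trans l1; lra.
have -> : 2 * pi * expR 1 / 12 = expR 1 * (pi / 6) :> R by field.
rewrite /log2 lnM ?posrE ?expR_gt0 ?divr_gt0// expRK; set l := ln (pi / 6).
have pi6 : 0 < pi / 6 :> R by rewrite divr_gt0.
(* The enclosure of ln(pi / 6) is tuned to the half-width 1/2000 with little to spare. The rational
   [c], here 1.910 and below 1.909, separates 6 / pi from the exponential. *)
have lo : - (647 + 181 / 1000) / 1000 < l.
  rewrite -ltr_expR lnK ?posrE// mulNr expRN invf_plt ?posrE ?expR_gt0//.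
  have [c cE] : exists c : R, c = 1 + 910 / 1000 by eexists.
  have c0 : 0 < c by lra.
  apply: (@lt_le_trans _ _ c).
    rewrite invf_plt ?posrE// -[c^-1]div1r ltr_pdivrMr//; nra.
  apply: le_trans (expR_ge_series _ 8 _); last by lra.
  rewrite cE !big_nat_recr//= big_nil !factS fact0 !natrM; lra.
have hi : l < - (645 + 83 / 100) / 1000.
  rewrite -ltr_expR lnK ?posrE// mulNr expRN invf_pgt ?posrE ?expR_gt0//.
  have [c cE] : exists c : R, c = 1 + 909 / 1000 by eexists.
  have c0 : 0 < c by lra.
  apply: (@le_lt_trans _ _ c); last first.
    rewrite invf_pgt ?posrE// -[c^-1]div1r ltr_pdivlMr//; nra.
  apply: le_trans (expR_le_series _ 8 _ _) _ => //; first by apply/andP; split; lra.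
  rewrite cE !big_nat_recr//= big_nil !factS fact0 !natrM; lra.
rewrite ltr_distl; apply/andP; split.
- by rewrite mulrA ltr_pdivlMr//; lra.
- by rewrite mulrA ltr_pdivrMr//; lra.
Qed.

End numerical_bounds.

(** * Calculus of the iterated [is_o1] *)

Section iterated_limits.
Context {R : realType}.
Implicit Types (eps : instance R -> R -> R).

Let size_cvg (s : nat -> instance R) :=
  (fun k => (nrow (s k) * ncol (s k))%N) @ \oo --> \oo.

Lemma limf_esup_le (F : set (set R)) (f : R -> \bar R) (e : \bar R) :
  F [set g | (f g <= e)%E] -> (limf_esup f F <= e)%E.
Proof.
move=> Fe; apply: (@le_trans _ _ (ereal_sup (f @` [set g | (f g <= e)%E]))).
  by apply: ereal_inf_lbound; exists [set g | (f g <= e)%E].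
by apply: ge_ereal_sup => _ [g /= ge <-].
Qed.

Lemma limf_esup_lt (F : set (set R)) (f : R -> \bar R) (e : \bar R) : Filter F ->
  (limf_esup f F < e)%E -> F [set g | (f g <= e)%E].
Proof.
move=> FF /ereal_inf_lt[_ [V FV <-]] Ve; apply: filterS FV => g Vg /=.
by apply: le_trans (ltW Ve); apply: ereal_sup_ubound; exists g.
Qed.

Lemma is_o1P eps : is_o1 eps <-> forall s, size_cvg s -> forall e : R, 0 < e ->
  \forall k \near \oo, \forall g \near 0^'+, `|eps (s k) g| <= e.
Proof.
have ge0 (f : R -> R) : (0 <= limf_esup (fun g : R => `|f g|%:E) 0^'+)%E.
  exact: limf_esup_ge0.
split=> [H1 s sc e e0|H s sc].
- have := H1 s sc => /(_ [set x | (x < e%:E)%E]) /=.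
  have : nbhs (0%E : \bar R) [set x | (x < e%:E)%E].
    by apply: open_nbhs_nbhs; split; [exact: open_ereal_lt_ereal|rewrite /= lte_fin].
  move=> nb /(_ nb) Hk.
  have {}Hk : \forall k \near \oo,
      (limf_esup (fun g : R => `|eps (s k) g|%:E) 0^'+ < e%:E)%E by exact: Hk.
  apply: filterS Hk => k /limf_esup_lt.
  by apply: filterS => g /=; rewrite lee_fin.
- move=> A /= [e /= e0 eA]; have e20 : 0 < e / 2 by rewrite divr_gt0.
  apply: filterS (H s sc _ e20) => k Hk /=.
  have := ge0 (eps (s k)).
  have : (limf_esup (fun g => `|eps (s k) g|%:E) 0^'+ <= (e / 2)%:E)%E.
    by apply: limf_esup_le; apply: filterS Hk => g; rewrite /= lee_fin.
  case: (limf_esup _ _) => [r| |] //; rewrite !lee_fin => re r0.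
  by apply: eA; rewrite /ball/= sub0r normrN ger0_norm//; lra.
Qed.

(** The threshold [dl] must be uniform in the instance, since the instance varies in the outer
    limit. *)
Lemma is_o1_comb eps1 eps2 eps : is_o1 eps1 -> is_o1 eps2 ->
  (forall e : R, 0 < e -> exists2 dl : R, 0 < dl & forall x g, 0 < g ->
    `|eps1 x g| <= dl -> `|eps2 x g| <= dl -> `|eps x g| <= e) ->
  is_o1 eps.
Proof.
move=> /is_o1P o1 /is_o1P o2 H; apply/is_o1P => s sc e /H[dl dl0 Hd].
apply: filterS2 (o1 s sc dl dl0) (o2 s sc dl dl0) => k k1 k2.
near=> g; apply: Hd; [by near: g; exact: nbhs_right_gt|by near: g|by near: g].
Unshelve. all: by end_near. Qed.

(** The constants may depend on the instance, which is fixed while [g] tends to 0. *)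
Lemma is_o1_linear eps :
  (forall x, exists C : R, exists2 dl : R, 0 < dl &
     forall g, 0 < g -> g <= dl -> `|eps x g| <= C * g) -> is_o1 eps.
Proof.
move=> H; apply/is_o1P => s _ e e0; apply: nearW => k.
have [C [dl dl0 HC]] := H (s k); pose C' := `|C| + 1.
have C'0 : 0 < C' by rewrite ltr_wpDl.
near=> g; have g0 : 0 < g by near: g; exact: nbhs_right_gt.
have gd : g <= dl by near: g; exact: nbhs_right_le.
have ge : g <= e / C' by near: g; apply: nbhs_right_le; rewrite divr_gt0.
apply: le_trans (HC g g0 gd) _; apply: (@le_trans _ _ (C' * g)).
  by rewrite ler_pM2r// /C' (le_trans (ler_norm C))// lerDl.
by rewrite mulrC -ler_pdivlMr.
Unshelve. all: by end_near. Qed.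

End iterated_limits.

(** * Asymptotics for a fixed instance *)

Section instance_scales.
Context {R : realType}.
Implicit Types (x : instance R) (g : R).

Lemma rev_cholesky_diag_gt0 p (M : 'M[R]_p) k : spdmx M -> 0 < rev_cholesky M k k.
Proof. by move=> /rev_choleskyP[]. Qed.

Lemma spdmx_det_gt0 p (M : 'M[R]_p) : spdmx M -> 0 < \det M.
Proof.
move=> spdM; rewrite det_rev_cholesky// exprn_gt0// prodr_gt0// => k _.
exact: rev_cholesky_diag_gt0.
Qed.

Lemma sum_ln_rev_cholesky p (M : 'M[R]_p) : spdmx M ->
  2 * \sum_k ln (rev_cholesky M k k) = ln (\det M).
Proof.
move=> spdM; have L0 k := rev_cholesky_diag_gt0 _ _ k spdM.
rewrite det_rev_cholesky// lnXn ?prodr_gt0// mulr_natl; congr (_ *+ _).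
apply: expR_inj; rewrite lnK ?posrE ?prodr_gt0// expR_sum.
by apply: eq_bigr => k _; rewrite lnK// posrE.
Qed.

Definition root_geodet x : R :=
  \det (matA x) `^ (2 * ncol x)%:R^-1 * \det (matB x) `^ (2 * nrow x)%:R^-1.

Definition diag_prod x (p : 'I_(nrow x) * 'I_(ncol x)) : R :=
  rev_cholesky (matA x) p.2 p.2 * rev_cholesky (matB x) p.1 p.1.

(** The step size at g = 1; by [step_sizeE] every step is [g] times this one. *)
Definition unit_step x (p : 'I_(nrow x) * 'I_(ncol x)) : R :=
  root_geodet x / diag_prod x p.

Lemma detA_gt0 x : 0 < \det (matA x). Proof. exact/spdmx_det_gt0/matA_spd. Qed.
Lemma detB_gt0 x : 0 < \det (matB x). Proof. exact/spdmx_det_gt0/matB_spd. Qed.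

Lemma root_geodet_gt0 x : 0 < root_geodet x.
Proof. by rewrite mulr_gt0// powR_gt0// (detA_gt0, detB_gt0). Qed.

Lemma diag_prod_gt0 x p : 0 < diag_prod x p.
Proof.
by rewrite mulr_gt0// rev_cholesky_diag_gt0//; [exact: matA_spd|exact: matB_spd].
Qed.

Lemma unit_step_gt0 x p : 0 < unit_step x p.
Proof. by rewrite divr_gt0 ?root_geodet_gt0 ?diag_prod_gt0. Qed.

Lemma root_geodet_sqr x : root_geodet x ^+ 2 = geodet x.
Proof.
have H (a : R) q : 0 < a -> (0 < q)%N -> (a `^ (2 * q)%:R^-1) ^+ 2 = a `^ q%:R^-1.
  move=> a0 q0; rewrite -powR_mulrn ?powR_ge0// -powRrM; congr (_ `^ _).
  by rewrite natrM; field; rewrite pnatr_eq0 -lt0n.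
by rewrite exprMn !H ?detA_gt0 ?detB_gt0 ?ncol_gt0 ?nrow_gt0.
Qed.

Lemma geodet_gt0 x : 0 < geodet x.
Proof. by rewrite -root_geodet_sqr exprn_gt0// root_geodet_gt0. Qed.

Lemma step_sizeE x g p : 0 <= g ->
  step_size (@scaleA R x g) (@scaleB R x g) p = g * unit_step x p.
Proof.
move=> g0; rewrite /step_size /scaleA /scaleB /gptq_scale /unit_step /diag_prod.
rewrite -{3}(sqr_sqrtr g0) /root_geodet expr2 invfM; ring.
Qed.

(** The geometric-mean normalization at work: the logarithms of each Cholesky diagonal sum to half
    the log-determinant. A cell thus has volume g^(mn). *)
Lemma sum_ln_unit_step x : \sum_p ln (unit_step x p) = 0.
Proof.
pose a := ln (\det (matA x)) / (2 * (ncol x)%:R).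
pose b := ln (\det (matB x)) / (2 * (nrow x)%:R).
pose lA j := ln (rev_cholesky (matA x) j j).
pose lB i := ln (rev_cholesky (matB x) i i).
have A0 j := rev_cholesky_diag_gt0 _ _ j (matA_spd x).
have B0 i := rev_cholesky_diag_gt0 _ _ i (matB_spd x).
have n0 : (ncol x)%:R != 0 :> R by rewrite pnatr_eq0 -lt0n ncol_gt0.
have m0 : (nrow x)%:R != 0 :> R by rewrite pnatr_eq0 -lt0n nrow_gt0.
have E p : ln (unit_step x p) = (a - lA p.2) + (b - lB p.1).
  rewrite ln_div ?posrE ?root_geodet_gt0 ?diag_prod_gt0//.
  rewrite /root_geodet /diag_prod !lnM ?posrE ?powR_gt0 ?detA_gt0 ?detB_gt0//.
  by rewrite !ln_powR /a /b /lA /lB !natrM; ring.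
have SA : \sum_j (a - lA j) = 0.
  rewrite big_split/= sumr_const card_ord sumrN -mulr_natl.
  have := sum_ln_rev_cholesky _ _ (matA_spd x); rewrite -/(\sum_j lA j) /a => <-.
  by field.
have SB : \sum_i (b - lB i) = 0.
  rewrite big_split/= sumr_const card_ord sumrN -mulr_natl.
  have := sum_ln_rev_cholesky _ _ (matB_spd x); rewrite -/(\sum_i lB i) /b => <-.
  by field.
rewrite (eq_bigr _ (fun p _ => E p)).
rewrite -(pair_bigA _ (fun i j => (a - lA j) + (b - lB i)))/=.
under eq_bigr do rewrite big_split/= SA add0r sumr_const card_ord.
by rewrite sumrMnl SB mul0rn.
Qed.

End instance_scales.

Section instance_asymptotics.
Context {R : realType} (sigma : R) (round : R -> int).
Hypothesis sigma_gt0 : 0 < sigma.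
Hypothesis round_nearest : is_nearest_int round.
Variable x : instance R.
Context {d} {T : measurableType d} (P : probability T R).
Variable W : 'I_(nrow x) * 'I_(ncol x) -> {RV P >-> R}.
Hypothesis W_normal : iid_normal sigma W.

Let N := (nrow x * ncol x)%N.
Let N_gt0 : 0 < N%:R :> R.
Proof. by rewrite ltr0n muln_gt0 nrow_gt0 ncol_gt0. Qed.

Let U := feedback (matA x) (matB x).
Let ks := @visits (nrow x) (ncol x).

Let random_matrixE w : (fun p => random_matrix W w p.1 p.2) = W^~ w.
Proof. by apply/funext => -[i j]; rewrite mxE. Qed.

Section fixed_scale.
Variable g : R.
Hypothesis g_gt0 : 0 < g.
Let s p := g * unit_step x p.

Let s_gt0 p : 0 < s p. Proof. by rewrite mulr_gt0// unit_step_gt0. Qed.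

Let step_sizeE' : step_size (@scaleA R x g) (@scaleB R x g) = s.
Proof. by apply/funext => p; rewrite step_sizeE// ltW. Qed.

Let e p w := err round s U ks (W^~ w) p.

Lemma distortionE SA SB : SA *m SA^T = matA x -> SB *m SB^T = matB x ->
  distortion round g W SA SB =
  ((N%:R^-1)%:E * \sum_p ((diag_prod x p ^+ 2)%:E * \int[P]_w (e p w ^+ 2)%:E))%E.
Proof.
move=> SAA SBB; rewrite /distortion; congr (_ * _)%E.
rewrite unlock.
transitivity (\int[P]_w (\sum_p ((diag_prod x p ^+ 2)%:E * (e p w ^+ 2)%:E)))%E.
  apply: eq_integral => w _.
  have [_ _ LAA] := rev_choleskyP _ _ (matA_spd x).
  have [_ _ LBB] := rev_choleskyP _ _ (matB_spd x).
  rewrite (frobenius_norm_sqrt _ _ _ _ _ _ _ _ _ SAA SBB LAA LBB).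
  rewrite frobenius_gptq; [|exact: matA_spd|exact: matB_spd].
  rewrite random_matrixE step_sizeE' -sumEFin; apply: eq_bigr => p _.
  by rewrite -EFinM -exprMn.
rewrite ge0_integral_sum//; last 2 first.
- move=> p; apply: emeasurable_funM => //; apply/measurable_EFinP.
  by apply: measurable_funX; exact: (measurable_err P W).
- by move=> p w _; rewrite -EFinM lee_fin mulr_ge0 ?sqr_ge0.
apply: eq_bigr => p _; rewrite ge0_integralZl_EFin//.
- by move=> w _; rewrite lee_fin sqr_ge0.
- by apply/measurable_EFinP/measurable_funX; exact: (measurable_err P W).
- exact: sqr_ge0.
Qed.

(** Finiteness follows from the pointwise bound s / 2, for every positive [g] and not only for small
    ones. *)
Lemma integral_err_fin p : exists v, (\int[P]_w (e p w ^+ 2)%:E = v%:E)%E.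
Proof.
have me : measurable_fun [set: T] (fun w => (e p w ^+ 2)%:E).
  by apply/measurable_EFinP/measurable_funX; exact: (measurable_err P W).
have : (\int[P]_w (e p w ^+ 2)%:E \is a fin_num)%E.
  rewrite ge0_fin_numE; last first.
    by apply: integral_ge0 => w _; rewrite lee_fin sqr_ge0.
  apply: (@le_lt_trans _ _ (\int[P]_w ((s p / 2) ^+ 2)%:E)%E).
    apply: ge0_le_integral => //.
    - by move=> w _; rewrite lee_fin sqr_ge0.
    - move=> w _; rewrite lee_fin -(real_normK (num_real (e p w))).
      have := err_le round s U round_nearest s_gt0 ks (W^~ w) p; rewrite -/(e p w) => ep.
      by rewrite lerXn2r// nnegrE// (le_trans _ ep).
  rewrite integral_cst// [X in (_ * X)%E](_ : _ = 1%E) ?mule1 ?ltry//.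
  exact: probability_setT.
by case: (integral _ _ _) => // v _; exists v.
Qed.

(** The scales equalize the entries: the weight of each one times its squared step is g^2
    [geodet x]. Finiteness holds for all [g], the estimate once all steps are at most 1. *)
Lemma distortion_bound (K : R) SA SB :
  SA *m SA^T = matA x -> SB *m SB^T = matB x ->
  (forall h a : R, 0 < h <= 1 ->
    ((h ^+ 2 / 12 - K * h ^+ 3)%:E <=
     \int[normal_prob 0 sigma]_y ((quant_err round (fun=> h) tt (y + a)) ^+ 2)%:E <=
     (h ^+ 2 / 12 + K * h ^+ 3)%:E)%E) ->
  exists2 r : R, distortion round g W SA SB = r%:E &
    (forall p, s p <= 1) ->
    `|r - g ^+ 2 / 12 * geodet x| <=
      geodet x * K * (\sum_p unit_step x p) / N%:R * g ^+ 3.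
Proof.
move=> SAA SBB HK.
have [v vE] : exists v : 'I_(nrow x) * 'I_(ncol x) -> R,
    forall p, (\int[P]_w (e p w ^+ 2)%:E = (v p)%:E)%E.
  by have /choice[v vE] := integral_err_fin; exists v.
exists (N%:R^-1 * \sum_p diag_prod x p ^+ 2 * v p).
  rewrite distortionE// EFinM -sumEFin; congr (_ * _)%E.
  by apply: eq_bigr => p _; rewrite vE EFinM.
move=> s1; have c0 := root_geodet_gt0 x.
have NE : N%:R = \sum_(p : 'I_(nrow x) * 'I_(ncol x)) 1 :> R.
  by rewrite sumr_const card_prod !card_ord.
have -> : N%:R^-1 * (\sum_p diag_prod x p ^+ 2 * v p) - g ^+ 2 / 12 * geodet x =
    N%:R^-1 * \sum_p (diag_prod x p ^+ 2 * v p - g ^+ 2 / 12 * geodet x).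
  rewrite sumrB mulrBr; congr (_ - _); rewrite sumr_const -mulr_natr card_prod !card_ord.
  by rewrite -/N; field; rewrite gt_eqF.
have -> : geodet x * K * (\sum_p unit_step x p) / N%:R * g ^+ 3 =
    N%:R^-1 * \sum_p g ^+ 3 * geodet x * K * unit_step x p.
  by rewrite -mulr_sumr; ring.
rewrite normrM gtr0_norm ?invr_gt0// ler_pM2l ?invr_gt0//.
apply: le_trans (ler_norm_sum _ _ _) _; apply: ler_sum => p _.
have /andP[] := integral_err_sqr P W round s U sigma round_nearest s_gt0 W_normal
  K HK ks p visits_uniq (mem_visits p) (s1 p).
rewrite vE !lee_fin => v1 v2.
have dE : diag_prod x p * s p = g * root_geodet x.
  by rewrite /s /unit_step; field; rewrite gt_eqF// diag_prod_gt0.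
have d2 : 0 < diag_prod x p ^+ 2 by rewrite exprn_gt0// diag_prod_gt0.
have E1 : diag_prod x p ^+ 2 * (s p ^+ 2 / 12) = g ^+ 2 / 12 * geodet x.
  by rewrite mulrA -exprMn dE exprMn root_geodet_sqr; ring.
have E2 : diag_prod x p ^+ 2 * (K * s p ^+ 3) =
    g ^+ 3 * geodet x * K * unit_step x p.
  transitivity ((diag_prod x p * s p) ^+ 2 * (K * s p)); first by ring.
  by rewrite dE exprMn root_geodet_sqr /s; ring.
rewrite -E2 -E1 -mulrBr normrM gtr0_norm// ler_pM2l// ler_distl.
by apply/andP; split.
Qed.

(** Cell radii are proportional to [g], and g <= 1 bounds the quadratic part of the slack by a
    multiple of [g]. *)
Lemma entropyZ_bound : exists2 e0 : R,
  (g <= 1 -> `|e0| <= (\sum_k 2 * cell_radius (unit_step x) U k *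
      (1 + cell_radius (unit_step x) U k + sigma ^+ 2) / sigma ^+ 2) * g) &
  entropyZ round g W =
    ((N%:R * (2^-1 - ln g - ln (normal_peak sigma)) + e0) / ln 2)%:E.
Proof.
pose zc (z : 'M[int]_(nrow x, ncol x)) p := z p.1 p.2.
have ZE z : (Zout round g \o random_matrix W) @^-1` [set z] =
    code_cell P W round s U ks (zc z).
  have E w p : Zout round g (random_matrix W w) p.1 p.2 =
      quant_code round s U ks (W^~ w) p.
    rewrite /Zout gptqE step_sizeE' random_matrixE; by case: p.
  apply/seteqP; split => [w /= <- p _|w H]; first by rewrite -E.
  by apply/matrixP => i j; rewrite /= (E w (i, j)) H// mem_visits.
have [e0 e0le EntE] := entropy_code P W round s U sigma round_nearest s_gt0 sigma_gt0
  W_normal ks visits_uniq mem_visits (feedback_diag _ _ (matA_spd x) (matB_spd x))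
  (feedback_visits _ _ (matA_spd x) (matB_spd x)) _ zc ZE.
exists e0.
  move=> g1; apply: le_trans e0le _; rewrite mulr_suml; apply: ler_sum => k _.
  have -> : cell_radius s U k = g * cell_radius (unit_step x) U k.
    rewrite /cell_radius mulrDr mulr_sumr; congr (_ + _); first by rewrite /s; ring.
    by apply: eq_bigr => j _; rewrite /s; ring.
  have r0 : 0 <= cell_radius (unit_step x) U k.
    by apply: cell_radius_ge0 => p; exact: unit_step_gt0.
  set r := cell_radius _ _ _ in r0 *.
  have -> : 2 * r * (1 + r + sigma ^+ 2) / sigma ^+ 2 * g =
    2 * (g * r) * (1 + r + sigma ^+ 2) / sigma ^+ 2 by ring.
  rewrite ler_pM2r ?invr_gt0 ?exprn_gt0// ler_wpM2l ?mulr_ge0 ?(ltW g_gt0)//.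
  by rewrite lerD2r lerD2l ler_piMl.
rewrite /entropyZ EntE; congr (((_ + _) / _)%:E).
transitivity (\sum_k ((2^-1 - ln g - ln (normal_peak sigma)) - ln (unit_step x k))).
  by apply: eq_bigr => k _; rewrite lnM ?posrE ?unit_step_gt0//; ring.
by rewrite sumrB sum_ln_unit_step subr0 sumr_const card_prod !card_ord mulr_natl.
Qed.

End fixed_scale.
End instance_asymptotics.

(** * From the two expansions to the tradeoff and the rate gap *)

Section tradeoff.
Context {R : realType}.
Implicit Types (a b e g G sigma : R).

Let ln2_gt0 : 0 < ln 2 :> R. Proof. by rewrite ln_gt0// ltr1n. Qed.

(** The differential entropy of the Gaussian in bits; the summand 1/2 supplies the factor e under
    the logarithm. *)
Lemma log2_normal_peak sigma g : 0 < sigma ->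
  (2^-1 - ln g - ln (normal_peak sigma)) / ln 2 =
  2^-1 * log2 (2 * pi * expR 1 * sigma ^+ 2) - log2 g.
Proof.
move=> s0; have p0 := @pi_gt0 R.
have q0 : 0 < 2 * pi * sigma ^+ 2 by rewrite !mulr_gt0 ?exprn_gt0.
have -> : ln (normal_peak sigma) = - (2^-1 * ln (2 * pi * sigma ^+ 2)).
  rewrite /normal_peak lnV ?posrE ?sqrtr_gt0 ?mulrn_wgt0 ?mulr_gt0 ?exprn_gt0//.
  have -> : sigma ^+ 2 * pi *+ 2 = 2 * pi * sigma ^+ 2 by rewrite -mulr_natr; ring.
  by rewrite -[in RHS](sqr_sqrtr (ltW q0)) lnXn ?sqrtr_gt0// -mulr_natl; field.
rewrite /log2 (_ : 2 * pi * expR 1 * sigma ^+ 2 = expR 1 * (2 * pi * sigma ^+ 2)); last by ring.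
by rewrite [ln (expR _ * _)]lnM ?posrE ?expR_gt0// expRK; field; rewrite gt_eqF.
Qed.

(** [e1] is the relative error of the distortion, [e2] the additive error of the rate; the factor
    exp(2 e2 ln 2) undoes what [e2] does to 2^(-2R). *)
Lemma distortion_rate_identity sigma g G e1 e2 : 0 < sigma -> 0 < g ->
  2 * pi * expR 1 / 12 * sigma ^+ 2 * G *
    2 `^ (- 2 * (2^-1 * log2 (2 * pi * expR 1 * sigma ^+ 2) - log2 g + e2)) *
    (1 + ((1 + e1) * expR (2 * e2 * ln 2) - 1)) =
  g ^+ 2 / 12 * G * (1 + e1).
Proof.
move=> s0 g0; have p0 := @pi_gt0 R.
have q0 : 0 < 2 * pi * expR 1 * sigma ^+ 2 by rewrite !mulr_gt0 ?exprn_gt0 ?expR_gt0.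
rewrite /powR pnatr_eq0/=; set q := 2 * pi * _ * _ in q0 *.
have -> : - 2 * (2^-1 * log2 q - log2 g + e2) * ln 2 =
    - ln q + (ln g + ln g) - 2 * e2 * ln 2.
  by rewrite /log2; field; rewrite gt_eqF.
rewrite !expRD !expRN !lnK ?posrE//.
have -> : 2 * pi * expR 1 / 12 * sigma ^+ 2 * G = q / 12 * G by rewrite /q; ring.
by field; rewrite !gt_eqF ?expR_gt0.
Qed.

Lemma rate_gap_identity sigma g G e1 e2 : 0 < sigma -> 0 < g -> 0 < G -> 0 < 1 + e1 ->
  2^-1 * log2 (2 * pi * expR 1 * sigma ^+ 2) - log2 g + e2 -
    2^-1 * log2 (sigma ^+ 2 * G / (g ^+ 2 / 12 * G * (1 + e1))) =
  2^-1 * log2 (2 * pi * expR 1 / 12) + (e2 + 2^-1 * (ln (1 + e1) / ln 2)).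
Proof.
move=> s0 g0 G0 e0; have p0 := @pi_gt0 R.
have c0 : 0 < 2 * pi * expR 1 :> R by rewrite !mulr_gt0 ?expR_gt0.
have -> : sigma ^+ 2 * G / (g ^+ 2 / 12 * G * (1 + e1)) =
    12 * sigma ^+ 2 / (g ^+ 2 * (1 + e1)) by field; rewrite !gt_eqF.
rewrite /log2 !ln_div ?posrE ?mulr_gt0 ?exprn_gt0//.
rewrite !lnM ?posrE ?mulr_gt0 ?exprn_gt0 ?expR_gt0//.
by field; rewrite gt_eqF.
Qed.

Lemma distortion_error_small e : 0 < e -> exists2 dl : R, 0 < dl & forall a b,
  `|a| <= dl -> `|b| <= dl -> `|(1 + a) * expR (2 * b * ln 2) - 1| <= e.
Proof.
move=> e0.
have c : (fun b : R => expR (2 * b * ln 2)) @ (0 : R) --> (1 : R).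
  rewrite -[X in _ --> X](_ : expR (2 * 0 * ln 2) = 1); last by rewrite mulr0 mul0r expR0.
  apply: continuous_comp; last exact: continuous_expR.
  by apply: cvgMl; apply: cvgMr; exact: cvg_id.
have m0 : 0 < Num.min 1 (e / 2) by rewrite lt_min ltr01 divr_gt0.
have [r /= r0 H] := (nbhs_ballP _ _).1 (cvgr_dist_le _ _ c _ m0).
(* The exponential stays below 2, so |a| <= e / 4 contributes at most e / 2, and the exponential's
   distance to 1 the other half. *)
exists (Num.min (r / 2) (e / 4)); first by rewrite lt_min !divr_gt0.
move=> a b; rewrite !le_min => /andP[_ ae] /andP[br _].
have : `|1 - expR (2 * b * ln 2)| <= Num.min 1 (e / 2).
  by apply: H; rewrite /ball/= sub0r normrN (le_lt_trans br)//; lra.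
set E := expR _; rewrite le_min => /andP[E1 E2].
have -> : (1 + a) * E - 1 = a * E - (1 - E) by ring.
have EE : `|E| <= 2 by rewrite gtr0_norm ?expR_gt0//; move: E1; rewrite ler_norml; lra.
apply: le_trans (ler_normB _ _) _; rewrite normrM.
have := ler_pM (normr_ge0 _) (normr_ge0 _) ae EE; lra.
Qed.

Lemma rate_error_small e : 0 < e -> exists2 dl : R, 0 < dl & forall a b,
  `|a| <= dl -> `|b| <= dl ->
  0 < 1 + a /\ `|b + 2^-1 * (ln (1 + a) / ln 2)| <= e.
Proof.
move=> e0.
have cl : ln (1 + a) @[a --> (0 : R)] --> ln (1 + 0 : R).
  apply: continuous_cvg; last first.
    by apply: cvgD; [exact: cvg_cst|exact: cvg_id].
  by apply: continuous_ln; rewrite addr0.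
have c : (fun a : R => 2^-1 * (ln (1 + a) / ln 2)) @ (0 : R) --> (0 : R).
  rewrite -[X in _ --> X](_ : 2^-1 * (ln (1 + 0) / ln 2) = 0); last first.
    by rewrite addr0 ln1 mul0r mulr0.
  by apply: cvgMr; apply: cvgMl; exact: cl.
have [r /= r0 H] := (nbhs_ballP _ _).1 (cvgr_dist_le _ _ c _ (divr_gt0 e0 (ltr0Sn _ 1))).
(* The cap 1/2 keeps 1 + a positive, as the logarithm requires. *)
exists (Num.min (r / 2) (Num.min (e / 2) 2^-1)).
  by rewrite !lt_min invr_gt0 ltr0n !divr_gt0.
move=> a b; rewrite !le_min => /and3P[ar _ a2] /and3P[_ be _]; split.
  by move: a2; rewrite ler_norml; lra.
have : `|0 - 2^-1 * (ln (1 + a) / ln 2)| <= e / 2.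
  by apply: H; rewrite /ball/= sub0r normrN (le_lt_trans ar)//; lra.
rewrite sub0r normrN => ae; apply: le_trans (ler_normD _ _) _; lra.
Qed.

End tradeoff.

(** * Assembly of the asymptotic statements *)

Theorem corollary3p2 (R : realType) (sigma : R) (sigma_gt0 : 0 < sigma)
    (round : R -> int) (round_nearest : is_nearest_int round)
    (d : nat -> nat -> measure_display)
    (T : forall m n : nat, measurableType (d m n))
    (P : forall m n : nat, probability (T m n) R)
    (W : forall m n : nat, 'I_m * 'I_n -> {RV (P m n) >-> R})
    (W_normal : forall m n : nat, iid_normal sigma (W m n))
    (SA : forall x : instance R, 'M[R]_(ncol x))
    (SB : forall x : instance R, 'M[R]_(nrow x))
    (SA_sqrt : forall x : instance R, SA x *m (SA x)^T = matA x)
    (SB_sqrt : forall x : instance R, SB x *m (SB x)^T = matB x)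
    (c : forall (x : instance R) (g : R),
        'M[int]_(nrow x, ncol x) -> seq bool)
    (c_prefix_free : forall (x : instance R) (g : R), 0 < g ->
        prefix_free (c x g))
    (c_length : exists2 eps : instance R -> R -> R, is_o1 eps &
        forall (x : instance R) (g : R), 0 < g ->
          expected_length round g (W (nrow x) (ncol x)) (c x g) =
          (entropyZ round g (W (nrow x) (ncol x)) +
             ((nrow x * ncol x)%:R * eps x g)%:E)%E) :
  let D (x : instance R) (g : R) : \bar R :=
    distortion round g (W (nrow x) (ncol x)) (SA x) (SB x) in
  let rho (x : instance R) (g : R) : \bar R :=
    rate round g (W (nrow x) (ncol x)) (c x g) in
  [/\ exists2 eps : instance R -> R -> R, is_o1 eps &
        forall (x : instance R) (g : R), 0 < g ->
          D x g = (g ^+ 2 / 12 * geodet x * (1 + eps x g))%:E,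
      exists2 eps : instance R -> R -> R, is_o1 eps &
        forall (x : instance R) (g : R), 0 < g ->
          rho x g = (2^-1 * log2 (2 * pi * expR 1 * sigma ^+ 2) - log2 g
                     + eps x g)%:E,
      exists2 eps : instance R -> R -> R, is_o1 eps &
        forall (x : instance R) (g : R), 0 < g ->
          fine (D x g) =
          2 * pi * expR 1 / 12 * sigma ^+ 2 * geodet x
            * 2 `^ (- 2 * fine (rho x g)) * (1 + eps x g),
      exists2 eps : instance R -> R -> R, is_o1 eps &
        forall (x : instance R) (g : R), 0 < g ->
          fine (rho x g) - 2^-1 * log2 (sigma ^+ 2 * geodet x / fine (D x g)) =
          2^-1 * log2 (2 * pi * expR 1 / 12) + eps x g
    & `|2^-1 * log2 (2 * pi * expR 1 / 12) - 255 / 1000| < 1 / 2000 :> R].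

Proof.
move=> D rho.
have ln2_gt0 : 0 < ln 2 :> R by rewrite ln_gt0// ltr1n.
have size_gt0 (x : instance R) : 0 < (nrow x * ncol x)%:R :> R.
  by rewrite ltr0n muln_gt0 nrow_gt0 ncol_gt0.
have [K K0 HK] := normal_quant_err_sqr round sigma round_nearest sigma_gt0.
pose target (x : instance R) g := g ^+ 2 / 12 * geodet x.
have target_gt0 x g : 0 < g -> 0 < target x g.
  by move=> g0; rewrite mulr_gt0 ?geodet_gt0// divr_gt0// exprn_gt0.
(* Defined by solving the claimed equation, so that the equation holds for every positive [g] and
   only the limit remains to be shown. *)
pose eps1 x g := fine (D x g) / target x g - 1.
have D_eps1 x g : 0 < g -> D x g = (target x g * (1 + eps1 x g))%:E.
  move=> g0; have [r rE _] := distortion_bound sigma round round_nearest x (P _ _)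
    (W _ _) (W_normal _ _) g g0 K _ _ (SA_sqrt x) (SB_sqrt x) HK.
  rewrite /eps1 /D rE /=; congr _%:E.
  by field; rewrite gt_eqF// target_gt0.
have o1_eps1 : is_o1 eps1.
  apply: is_o1_linear => x.
  pose S : R := \sum_p unit_step x p.
  have S0 : 0 <= S by apply: sumr_ge0 => p _; exact/ltW/unit_step_gt0.
  (* For g <= 1 / (1 + S) every step g [unit_step x p] is at most 1, as the distortion estimate
     demands. *)
  exists (12 * K * S / (nrow x * ncol x)%:R), (1 + S)^-1.
    by rewrite invr_gt0 ltr_wpDr.
  move=> g g0 gS; have [r rE rb] := distortion_bound sigma round round_nearest x (P _ _)
    (W _ _) (W_normal _ _) g g0 K _ _ (SA_sqrt x) (SB_sqrt x) HK.
  have t0 := target_gt0 x g g0.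
  have -> : eps1 x g = (r - target x g) / target x g.
    by rewrite /eps1 /D rE /=; field; rewrite gt_eqF.
  rewrite normrM normfV (gtr0_norm t0) ler_pdivrMr//; apply: le_trans (rb _) _.
    move=> p; apply: le_trans (_ : g * (1 + S) <= 1); last first.
      by rewrite -ler_pdivlMr ?ltr_wpDr// mul1r.
    rewrite ler_pM2l// /S (bigD1 p)//= addrCA lerDl addr_ge0//.
    by apply: sumr_ge0 => q _; exact/ltW/unit_step_gt0.
  have := size_gt0 x; set N := (_ * _)%:R => N0.
  rewrite /target -/S le_eqVlt; apply/orP; left; apply/eqP.
  by clearbody N S; field; rewrite gt_eqF.
pose ideal g := 2^-1 * log2 (2 * pi * expR 1 * sigma ^+ 2) - log2 g.
pose epsZ (x : instance R) g :=
  fine (entropyZ round g (W (nrow x) (ncol x))) / (nrow x * ncol x)%:R - ideal g.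
pose U (x : instance R) := feedback (matA x) (matB x).
pose C (x : instance R) : R := \sum_k 2 * cell_radius (unit_step x) (U x) k *
  (1 + cell_radius (unit_step x) (U x) k + sigma ^+ 2) / sigma ^+ 2.
have entropy_bound x g : 0 < g -> exists e0 : R,
    [/\ entropyZ round g (W (nrow x) (ncol x)) =
          ((nrow x * ncol x)%:R * ideal g + e0 / ln 2)%:E,
        epsZ x g = e0 / ((nrow x * ncol x)%:R * ln 2)
      & g <= 1 -> `|e0| <= C x * g].
  move=> g0; have [e0 e0C EZ] := entropyZ_bound sigma round sigma_gt0 round_nearest x
    (P _ _) (W _ _) (W_normal _ _) g g0.
  exists e0; rewrite mulrDl -mulrA log2_normal_peak// -/(ideal g) in EZ.
  split=> //; rewrite /epsZ EZ /=; have := size_gt0 x; set N := (_ * _)%:R => N0.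
  by clearbody N; field; rewrite !gt_eqF.
have Ent_epsZ x g : 0 < g -> entropyZ round g (W (nrow x) (ncol x)) =
    ((nrow x * ncol x)%:R * (ideal g + epsZ x g))%:E.
  move=> /(entropy_bound x)[e0 [-> -> _]]; congr _%:E.
  have := size_gt0 x; set N := (_ * _)%:R => N0.
  by clearbody N; field; rewrite !gt_eqF.
have o1_epsZ : is_o1 epsZ.
  apply: is_o1_linear => x; exists (C x / ((nrow x * ncol x)%:R * ln 2)), 1 => // g g0 g1.
  have N0 : 0 < (nrow x * ncol x)%:R * ln 2 :> R by rewrite mulr_gt0.
  have [e0 [_ -> /(_ g1) e0C]] := entropy_bound x g g0.
  by rewrite normrM normfV (gtr0_norm N0) mulrAC ler_pM2r ?invr_gt0.
have [epsc o1_epsc lengthE] := c_length.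
pose eps2 x g := epsZ x g + epsc x g.
have o1_eps2 : is_o1 eps2.
  apply: (is_o1_comb _ _ _ o1_epsZ o1_epsc) => e e0; exists (e / 2).
    by rewrite divr_gt0.
  move=> x g _ a b; apply: le_trans (ler_normD _ _) _; lra.
have rho_eps2 x g : 0 < g -> rho x g = (ideal g + eps2 x g)%:E.
  move=> g0; rewrite /rho /rate lengthE// Ent_epsZ// -EFinD -EFinM /eps2.
  have := size_gt0 x; set N := (_ * _)%:R => N0.
  by clearbody N; congr _%:E; field; rewrite gt_eqF.
split; last exact: half_log2_gap_bound.
- by exists eps1.
- by exists eps2.
- exists (fun x g => (1 + eps1 x g) * expR (2 * eps2 x g * ln 2) - 1).
    apply: (is_o1_comb _ _ _ o1_eps1 o1_eps2) => e /distortion_error_small[dl dl0 Hdl].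
    by exists dl => // x g _; exact: Hdl.
  by move=> x g g0; rewrite D_eps1// rho_eps2//= distortion_rate_identity.
(* Taken as a difference, because the closed form of the error needs 1 + [eps1] > 0, which the limit
   argument provides only when [eps1] is small. *)
exists (fun x g => fine (rho x g) - 2^-1 * log2 (sigma ^+ 2 * geodet x / fine (D x g))
  - 2^-1 * log2 (2 * pi * expR 1 / 12)); last by move=> x g _; rewrite [RHS]addrC subrK.
apply: (is_o1_comb _ _ _ o1_eps1 o1_eps2) => e /rate_error_small[dl dl0 Hdl].
exists dl => // x g g0 e1 e2; have [e1_gt0] := Hdl _ _ e1 e2.
rewrite D_eps1// rho_eps2//= rate_gap_identity ?geodet_gt0//.
by rewrite (addrC (2^-1 * log2 _)) addrK.
Qed.
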